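(* For most $d$-norms $\|\cdot\|$ the following holds: for every finite set $P\subset\mathbb{R}^d$ there exists a point $x\in P$ such that the set $\{\|x-y\|:y\in P\}$ has $\Omega\!\left(\frac{|P|}{(\log|P|)^2}\right)$ elements, where the implicit constant depends only on the norm $\|\cdot\|$.
   Context: A $d$-norm is a norm on $\mathbb{R}^d$. Let $B_d$ be the space of all $d$-norms equipped with the Hausdorff metric (on their unit balls); it is a Baire space. A property holds for ''most $d$-norms'' if it holds for all $d$-norms outside a meagre subset of $B_d$. $X=\Omega(Y)$ means there is $c>0$ independent of $P$ with $X\ge cY$ for all sufficiently large $|P|$. *)

(* Defs.v *)
From HB Require Import structures.
From mathcomp Require Import all_boot all_order all_algebra finmap.
From mathcomp Require Import all_classical all_reals all_analysis.
From mathcomp Require Import ring.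

Set Implicit Arguments.
Unset Strict Implicit.
Unset Printing Implicit Defensive.

Import Order.TTheory GRing.Theory Num.Theory.
Import numFieldNormedType.Exports.

Local Open Scope classical_set_scope.
Local Open Scope ring_scope.

Section Meagre.
Variable T : topologicalType.
Implicit Type A : set T.

Definition nowhere_dense A : Prop := (closure A)° = set0.

Definition meagre A : Prop :=
  exists2 F : nat -> set T,
    (forall n, nowhere_dense (F n)) & A = \bigcup_n F n.

Definition holds_for_most (Q : T -> Prop) : Prop :=
  exists2 A, meagre A & forall x, ~ A x -> Q x.

End Meagre.

(* The library puts the sup norm on ['rV[R]_d]; the Hausdorff distance is
   taken with respect to the Euclidean norm. *)
Section Hausdorff.
Variables (R : realType) (d : nat).
Implicit Types (x y : 'rV[R]_d) (A B C : set 'rV[R]_d).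

Definition enorm x : R := Num.sqrt (\sum_i x 0 i ^+ 2).

Definition thickening (e : R) A : set 'rV[R]_d :=
  [set x | exists2 a, A a & enorm (x - a) <= e].

Definition hausdorff_radii A B : set R :=
  [set e | [/\ 0 <= e, A `<=` thickening e B & B `<=` thickening e A]].

(* [inf] is the usual infimum only when [hausdorff_radii A B] is nonempty,
   which holds for nonempty bounded sets. *)
Definition hausdorff_dist A B : R := inf (hausdorff_radii A B).

Lemma enorm_ge0 x : 0 <= enorm x.
Proof. exact: sqrtr_ge0. Qed.

Lemma sqr_enorm x : enorm x ^+ 2 = \sum_i x 0 i ^+ 2.
Proof. by rewrite sqr_sqrtr// sumr_ge0// => i _; exact: sqr_ge0. Qed.

Lemma enorm0 : enorm 0 = 0.
Proof. by rewrite /enorm big1 ?sqrtr0// => i _; rewrite mxE expr0n. Qed.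

Lemma enormN x : enorm (- x) = enorm x.
Proof. by congr Num.sqrt; apply: eq_bigr => i _; rewrite mxE sqrrN. Qed.

Lemma ler_coord_enorm x i : `|x 0 i| <= enorm x.
Proof.
rewrite -sqrtr_sqr ler_wsqrtr// (bigD1 i)//= lerDl sumr_ge0// => j _.
exact: sqr_ge0.
Qed.

Lemma enorm_eq0 x : enorm x = 0 -> x = 0.
Proof.
move=> x0; apply/rowP => i; rewrite mxE; apply/normr0_eq0/le_anti.
by rewrite normr_ge0 andbT -x0 ler_coord_enorm.
Qed.

Lemma ler_dot_enorm x y : \sum_i x 0 i * y 0 i <= enorm x * enorm y.
Proof.
have [/eqP/enorm_eq0 -> | px] := boolP (enorm x == 0).
  rewrite big1 ?mulr_ge0 ?enorm_ge0// => i _; by rewrite mxE mul0r.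
have [/eqP/enorm_eq0 -> | py] := boolP (enorm y == 0).
  rewrite big1 ?mulr_ge0 ?enorm_ge0// => i _; by rewrite mxE mulr0.
have {}px : 0 < enorm x by rewrite lt_neqAle eq_sym px enorm_ge0.
have {}py : 0 < enorm y by rewrite lt_neqAle eq_sym py enorm_ge0.
have : 0 <= \sum_i (enorm y * x 0 i - enorm x * y 0 i) ^+ 2.
  by rewrite sumr_ge0// => i _; exact: sqr_ge0.
have -> : \sum_i (enorm y * x 0 i - enorm x * y 0 i) ^+ 2 =
    (enorm x * enorm y *+ 2) *
    (enorm x * enorm y - \sum_i x 0 i * y 0 i).
  transitivity (enorm y ^+ 2 * (\sum_i x 0 i ^+ 2)
     + enorm x ^+ 2 * (\sum_i y 0 i ^+ 2)
     - enorm x * enorm y *+ 2 * \sum_i x 0 i * y 0 i).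
    rewrite !mulr_sumr -big_split/= -sumrB; apply: eq_bigr => i _.
    by ring.
  by rewrite -!sqr_enorm; ring.
by rewrite pmulr_rge0 ?subr_ge0// mulrn_wgt0// mulr_gt0.
Qed.

Lemma ler_enormD x y : enorm (x + y) <= enorm x + enorm y.
Proof.
rewrite -(@ler_pXn2r _ 2)// ?nnegrE ?addr_ge0 ?enorm_ge0// sqr_enorm.
have -> : \sum_i (x + y) 0 i ^+ 2 =
    enorm x ^+ 2 + enorm y ^+ 2 + (\sum_i x 0 i * y 0 i) *+ 2.
  rewrite !sqr_enorm -sumrMnl -!big_split/=; apply: eq_bigr => i _.
  by rewrite mxE; ring.
by rewrite sqrrD addrAC lerD2r lerD2l lerMn2r ler_dot_enorm.
Qed.

Lemma enorm_le_norm x : enorm x <= Num.sqrt d%:R * `|x|.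
Proof.
rewrite -(ger0_norm (normr_ge0 x)) -sqrtr_sqr -sqrtrM ?ler0n// ler_wsqrtr//.
rewrite -[X in X%:R * _](card_ord d) mulr_natl -sumr_const ler_sum// => i _.
rewrite -real_normK ?num_real// ler_pXn2r ?nnegrE ?normr_ge0//.
rewrite [leRHS]/Num.norm/= mx_normrE.
by apply/bigmax_geP; right; exists (0, i).
Qed.

Lemma subset_thickeningD e1 e2 A B C :
  A `<=` thickening e1 B -> B `<=` thickening e2 C ->
  A `<=` thickening (e1 + e2) C.
Proof.
move=> AB BC a /AB[b /BC[c Cc bc] ab]; exists c => //.
by rewrite -(subrKA b) (le_trans (ler_enormD _ _))// lerD.
Qed.

Lemma hausdorff_radii_lb A B : has_lbound (hausdorff_radii A B).
Proof. by exists 0 => e []. Qed.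

Lemma hausdorff_distxx A : hausdorff_dist A A = 0.
Proof.
have AA : A `<=` thickening 0 A.
  by move=> a Aa; exists a => //; rewrite subrr enorm0.
apply/le_anti/andP; split.
  by apply: ge_inf; [exact: hausdorff_radii_lb | split].
by apply: lb_le_inf; [exists 0; split | move=> e []].
Qed.

Lemma hausdorff_dist_sym A B : hausdorff_dist A B = hausdorff_dist B A.
Proof. by congr inf; apply/seteqP; split => e []. Qed.

Lemma hausdorff_dist_triangle B A C :
  hausdorff_radii A B !=set0 -> hausdorff_radii B C !=set0 ->
  hausdorff_dist A C <= hausdorff_dist A B + hausdorff_dist B C.
Proof.
move=> AB BC; rewrite -lerBlDr; apply: lb_le_inf => // e1 [e10 sAB sBA].
rewrite lerBlDr -lerBlDl; apply: lb_le_inf => // e2 [e20 sBC sCB].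
rewrite lerBlDl; apply: ge_inf; first exact: hausdorff_radii_lb.
split; first exact: addr_ge0.
- exact: subset_thickeningD sAB sBC.
- by rewrite addrC; exact: subset_thickeningD sCB sBA.
Qed.

Lemma hausdorff_radii_bounded r A B : A 0 -> B 0 ->
  (forall x, A x -> enorm x <= r) -> (forall x, B x -> enorm x <= r) ->
  hausdorff_radii A B r.
Proof.
move=> A0 B0 Ar Br; split.
- by rewrite -enorm0 Ar.
- by move=> a /Ar ar; exists 0; rewrite ?subr0.
- by move=> b /Br br; exists 0; rewrite ?subr0.
Qed.

Lemma hausdorff_dist0_approx A B : hausdorff_radii A B !=set0 ->
  hausdorff_dist A B = 0 ->
  forall e, 0 < e -> A `<=` thickening e B.
Proof.
move=> AB0 AB e e0 a Aa.
have [] := @inf_adherent R (hausdorff_radii A B) e e0.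
  by split => //; exact: hausdorff_radii_lb.
move=> r [r0 sAB _]; rewrite -/(hausdorff_dist A B) AB add0r => re.
have [b Bb abr] := sAB _ Aa; exists b => //.
exact: le_trans abr (ltW re).
Qed.

End Hausdorff.

Record dnorm (R : realType) (d : nat) := DNorm {
  dnorm_fun :> 'rV[R]_d -> R ;
  ler_dnormD : forall x y, dnorm_fun (x + y) <= dnorm_fun x + dnorm_fun y ;
  dnormZ : forall a x, dnorm_fun (a *: x) = `|a| * dnorm_fun x ;
  dnorm0_eq0 : forall x, dnorm_fun x = 0 -> x = 0 }.

Section DnormSpace.
Variables (R : realType) (d : nat).
Implicit Types (N M : dnorm R d) (x y : 'rV[R]_d).

Definition unit_ball N : set 'rV[R]_d := [set x | N x <= 1].

Definition dnorm_dist N M : R := hausdorff_dist (unit_ball N) (unit_ball M).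

Lemma dnorm_ext N M : (forall x, N x = M x) -> N = M.
Proof.
case: N M => [f fD fZ f0] [g gD gZ g0] /= /funext fg; rewrite {}fg in fD fZ f0 *.
by congr DNorm; exact: Prop_irrelevance.
Qed.

Lemma dnorm0 N : N 0 = 0.
Proof. by rewrite -(scale0r 0) dnormZ normr0 mul0r. Qed.

Lemma dnormN N x : N (- x) = N x.
Proof. by rewrite -scaleN1r dnormZ normrN1 mul1r. Qed.

Lemma dnorm_ge0 N x : 0 <= N x.
Proof.
by have := ler_dnormD N x (- x); rewrite subrr dnorm0 dnormN -mulr2n pmulrn_lge0.
Qed.

Lemma dnorm_gt0 N x : x != 0 -> 0 < N x.
Proof.
move=> x0; rewrite lt_neqAle dnorm_ge0 andbT eq_sym.
by apply: contra x0 => /eqP/dnorm0_eq0 ->.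
Qed.

Lemma ler_dnormB N x y : `|N x - N y| <= N (x - y).
Proof.
have h u v : N u - N v <= N (u - v).
  by rewrite lerBlDr -{1}(subrK v u) ler_dnormD.
by rewrite ler_norml h andbT lerNl opprB -(dnormN N (x - y)) opprB h.
Qed.

Lemma dnorm_le_coord N x (r : R) : (forall i, `|x 0 i| <= r) ->
  N x <= (\sum_i N (delta_mx 0 i)) * r.
Proof.
move=> xr; rewrite [in N x](row_sum_delta x) mulr_suml.
apply: (@le_trans _ _ (\sum_i N (x 0 i *: delta_mx 0 i))).
  apply: (big_ind2 (fun u v => N u <= v)) => //; first by rewrite dnorm0.
  by move=> u1 v1 u2 v2 h1 h2; rewrite (le_trans (ler_dnormD _ _ _))// lerD.
by apply: ler_sum => i _; rewrite dnormZ mulrC ler_wpM2l ?dnorm_ge0.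
Qed.

Lemma dnorm_le_enorm N x : N x <= (\sum_i N (delta_mx 0 i)) * enorm x.
Proof. by apply: dnorm_le_coord => i; exact: ler_coord_enorm. Qed.

Lemma coord_le_norm x i : `|x 0 i| <= `|x|.
Proof.
rewrite [leRHS]/Num.norm/= mx_normrE.
by apply/bigmax_geP; right; exists (0, i).
Qed.

Lemma dnorm_continuous N : continuous (N : 'rV[R]_d -> R).
Proof.
move=> x; apply/(@cvgrPdist_le _ _ _ (nbhs x)) => e e0.
set C := \sum_i N (delta_mx 0 i).
have C0 : 0 <= C by apply: sumr_ge0 => i _; exact: dnorm_ge0.
have C1 : 0 < C + 1 by rewrite ltr_wpDl.
near=> y; rewrite (le_trans (ler_dnormB _ _ _))//.
rewrite (le_trans (dnorm_le_coord N (coord_le_norm (x - y))))//.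
rewrite (@le_trans _ _ ((C + 1) * `|x - y|))//.
  by rewrite ler_wpM2r ?normr_ge0// lerDl.
rewrite -ler_pdivlMl// mulrC; near: y.
apply: (@cvgr_dist_le _ _ _ (nbhs x) _ id x); first exact: cvg_id.
exact: divr_gt0.
Unshelve. all: by end_near. Qed.

Lemma norm_le_dnorm N : exists2 c : R, 0 < c & forall x, c * `|x| <= N x.
Proof.
pose K : set 'rV[R]_d := [set x | `|x| = 1].
have inK x : x != 0 -> K (`|x|^-1 *: x).
  by move=> x0; rewrite /K/= normrZ normfV normr_id mulVf// normr_eq0.
have [K0|/set0P K0] := eqVneq K set0.
  exists 1 => // x; have [->|/inK] := eqVneq x 0; last by rewrite K0.
  by rewrite normr0 mulr0 dnorm0.
have cK : compact K.
  apply: bounded_closed_compact.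
    exists 1; split; first exact: num_real.
    by move=> r r1 x /= ->; exact: ltW.
  have -> : K = Num.norm @^-1` [set (1 : R)] by [].
  apply: closed_comp; first by move=> x _; exact: norm_continuous.
  exact: closed_eq.
have [|c cK' cmin] := EVT_min_rV K0 cK (f := N).
  by apply: continuous_subspaceT; exact: dnorm_continuous.
rewrite inE /K/= in cK'.
have c0 : c != 0 by rewrite -normr_eq0 cK' oner_neq0.
exists (N c); first exact: dnorm_gt0.
move=> x; have [->|x0] := eqVneq x 0; first by rewrite normr0 mulr0 dnorm_ge0.
have := cmin (`|x|^-1 *: x); rewrite inE => /(_ (inK _ x0)).
by rewrite dnormZ normfV normr_id mulrC ler_pdivlMr ?normr_gt0.
Qed.

Lemma unit_ball0 N : unit_ball N 0.
Proof. by rewrite /unit_ball/= dnorm0. Qed.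

Lemma unit_ball_bounded N :
  exists r : R, forall x, unit_ball N x -> enorm x <= r.
Proof.
have [c c0 cN] := norm_le_dnorm N.
exists (Num.sqrt d%:R * c^-1) => x Nx.
rewrite (le_trans (enorm_le_norm x))// ler_wpM2l ?sqrtr_ge0//.
by rewrite -[leRHS]mul1r ler_pdivlMr// mulrC (le_trans (cN x)).
Qed.

Lemma unit_ball_radii N M :
  hausdorff_radii (unit_ball N) (unit_ball M) !=set0.
Proof.
have [r1 h1] := unit_ball_bounded N; have [r2 h2] := unit_ball_bounded M.
exists (Num.max r1 r2).
apply: hausdorff_radii_bounded; try exact: unit_ball0.
- by move=> x /h1 h; rewrite le_max h.
- by move=> x /h2 h; rewrite le_max h orbT.
Qed.

Lemma dnorm_distxx N : dnorm_dist N N = 0.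
Proof. exact: hausdorff_distxx. Qed.

Lemma dnorm_dist_sym N M : dnorm_dist N M = dnorm_dist M N.
Proof. exact: hausdorff_dist_sym. Qed.

Lemma dnorm_dist_triangle M N L :
  dnorm_dist N L <= dnorm_dist N M + dnorm_dist M L.
Proof. by apply: hausdorff_dist_triangle; exact: unit_ball_radii. Qed.

Lemma dnorm_dist0_le N M : dnorm_dist N M = 0 -> forall x, M x <= N x.
Proof.
move=> NM.
have sub x : N x <= 1 -> M x <= 1.
  move=> Nx; apply/ler_addgt0Pr => e e0.
  set C := \sum_i M (delta_mx 0 i).
  have C0 : 0 <= C by apply: sumr_ge0 => i _; exact: dnorm_ge0.
  have C1 : 0 < C + 1 by rewrite ltr_wpDl.
  have [|y My xy] := hausdorff_dist0_approx (unit_ball_radii N M) NM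
    (e := e / (C + 1)) _ Nx; first exact: divr_gt0.
  rewrite -(subrK y x) addrC (le_trans (ler_dnormD _ _ _))// lerD//.
  rewrite (le_trans (dnorm_le_enorm _ _))//.
  rewrite (@le_trans _ _ ((C + 1) * enorm (x - y)))//.
    by rewrite ler_wpM2r ?enorm_ge0// lerDl.
  by rewrite -ler_pdivlMl// mulrC.
move=> x; have [->|x0] := eqVneq x 0; first by rewrite !dnorm0.
have Nx0 := dnorm_gt0 N x0.
have := sub ((N x)^-1 *: x); rewrite !dnormZ normfV (gtr0_norm Nx0).
by rewrite mulVf ?gt_eqF// => /(_ (lexx _)); rewrite mulrC ler_pdivrMr// mul1r.
Qed.

Lemma dnorm_dist_eq0 N M : dnorm_dist N M = 0 -> N = M.
Proof.
move=> NM; apply: dnorm_ext => x; apply/le_anti.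
by rewrite !dnorm_dist0_le// dnorm_dist_sym.
Qed.

HB.instance Definition _ := gen_eqMixin (dnorm R d).
HB.instance Definition _ := gen_choiceMixin (dnorm R d).
HB.instance Definition _ := @isMetric.Build R (dnorm R d) dnorm_dist
  dnorm_distxx dnorm_dist_eq0 dnorm_dist_sym dnorm_dist_triangle.

End DnormSpace.

Definition distances_from (R : realType) (d : nat) (N : dnorm R d)
    (P : {fset 'rV[R]_d}) (x : 'rV[R]_d) : {fset R} :=
  [fset N (x - y) | y in P]%fset.

(* Main.v *)
(** For a typical norm, the subgroup generated by [m] unit vectors contains at most
    [2 d m] unit vectors: more of them would impose more equations on the [m]
    generators than these have real coordinates, and such a coincidence is
    destroyed by a small generic perturbation of the norm. There are countably many
    patterns of integer coefficients, hence a meagre set of exceptional norms.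

    For such a norm, [n] points span [O(n (log n)^2)] unit distances. A smallest
    counterexample is an expander, since [x log x] is superadditive: every cut is
    crossed by at least [C log n] distinct unit difference vectors. Choosing such
    vectors greedily, a small fraction of all the unit differences, say [S], makes
    all the points congruent modulo the subgroup generated by [S], which therefore
    contains all the unit differences: too many for its number of generators.

    Finally let [E_a] be the pairs at distance [a] and [V_a] the points occurring in
    them. By scaling, [|E_a| = O(|V_a| (log n)^2)]; summing over [a], the left-hand
    sides give all the pairs, while [\sum_a |V_a|] is the total number of distances
    seen from the points. *)

Require Import Defs.
From mathcomp Require Import all_boot all_order all_algebra finmap.
From mathcomp Require Import all_classical all_reals all_analysis.
From mathcomp Require Import ring lra zify.

Set Implicit Arguments.
Unset Strict Implicit.
Unset Printing Implicit Defensive.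

Import Order.TTheory GRing.Theory Num.Theory.
Import numFieldNormedType.Exports.
Import Defs.

Local Open Scope ring_scope.

(** * Subgroups generated by unit differences *)

Definition zspan (V : zmodType) (S : seq V) (w : V) : Prop :=
  exists a : nat -> int, w = \sum_(i < size S) S`_i *~ a i.

Section ZSpan.
Variable V : zmodType.
Implicit Types (S : seq V) (v w : V).

Lemma zspan0 S : zspan S 0.
Proof. by exists (fun=> 0); rewrite big1// => i _; rewrite mulr0z. Qed.

Lemma zspanB S v w : zspan S v -> zspan S w -> zspan S (v - w).
Proof.
move=> [a ->] [b ->]; exists (fun i => a i - b i).
by rewrite -sumrB; apply: eq_bigr => i _; rewrite mulrzBr.
Qed.

Lemma zspan_cons v S w : zspan S w -> zspan (v :: S) w.
Proof.
move=> [a ->]; exists (fun i => if i is j.+1 then a j else 0).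
by rewrite big_ord_recl/= mulr0z add0r.
Qed.

Lemma zspan_head v S : zspan (v :: S) v.
Proof.
exists (fun i => (i == 0%N)%:Z); rewrite big_ord_recl/= mulr1z.
by rewrite big1 ?addr0// => i _; rewrite mulr0z.
Qed.

Lemma zspanN S v : zspan S v -> zspan S (- v).
Proof. by move=> Sv; rewrite -sub0r; exact: zspanB (zspan0 S) Sv. Qed.

Lemma zspanD S v w : zspan S v -> zspan S w -> zspan S (v + w).
Proof. by move=> Sv /zspanN Sw; rewrite -(opprK w); exact: zspanB. Qed.

End ZSpan.

(** A fibre of [f] in [A] that meets [B] has at least two elements, so in every fibre 2 plus the
    number of elements of [B] is at most twice its size. *)
Lemma leq_card_merge (T1 T2 : finType) (f : T1 -> T2) (A B : {set T1}) :
  B \subset A ->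
  (forall b, b \in B -> exists a, [/\ a \in A, a != b & f a = f b]) ->
  (2 * #|f @: A| + #|B| <= 2 * #|A|)%N.
Proof.
move=> BA BP.
have card_fib (X : {set T1}) : X \subset A ->
    #|X| = (\sum_(y in f @: A) #|[set x in X | f x == y]|)%N.
  move=> XA; rewrite -sum1_card.
  rewrite (partition_big f [in f @: A]) /=; last first.
    by move=> x xX; apply: imset_f; exact: (fintype.subsetP XA).
  apply: eq_bigr => y _; rewrite -sum1_card; apply: eq_bigl => x.
  by rewrite inE.
rewrite (card_fib _ BA) (card_fib _ (subxx A)) big_distrr/=.
rewrite -sum1_card big_distrr/= -big_split/=; apply: leq_sum => y /imsetP[x xA yx].
set FB := [set x in B | _]; set FA := [set x in A | _].
have sBA : FB \subset FA.
  by apply/fintype.subsetP => z; rewrite !inE => /andP[/(fintype.subsetP BA)-> ->].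
have FA1 : (0 < #|FA|)%N by apply/card_gt0P; exists x; rewrite inE xA yx eqxx.
have [->|/finset.set0Pn[b]] := eqVneq FB finset.set0; first by rewrite cards0; lia.
rewrite inE => /andP[bB /eqP fb]; have [a [aA ab fab]] := BP _ bB.
have : (2 <= #|FA|)%N.
  have -> : 2%N = #|[set a; b]| by rewrite cards2 ab.
  apply: subset_leq_card; apply/fintype.subsetP => z; rewrite !inE => /orP[]/eqP->.
    by rewrite aA fab fb eqxx.
  by rewrite (fintype.subsetP BA _ bB) fb eqxx.
have := subset_leq_card sBA; lia.
Qed.

Section UnitDifferences.
Variables (V : zmodType) (E : pred V) (T : finType) (p : T -> V).
Hypothesis p_inj : injective p.
Implicit Types (A B U : {set T}) (S : seq V).

Definition difference_type := seq_sub (codom (fun z : T * T => p z.1 - p z.2)).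

Definition difference (z : T * T) : difference_type :=
  SeqSub (codom_f (fun z : T * T => p z.1 - p z.2) z).

Definition unit_pairs A B : {set T * T} :=
  [set z in finset.setX A B | E (p z.1 - p z.2)].

Definition unit_differences A B : {set difference_type} :=
  difference @: unit_pairs A B.

(** A pair is determined by its first point and its difference. *)
Lemma leq_unit_pairs_l A B :
  (#|unit_pairs A B| <= #|A| * #|unit_differences A B|)%N.
Proof.
rewrite -(card_in_imset (f := fun z => (z.1, difference z))); last first.
  move=> [x y] [x' y'] _ _ /= [<- xy]; congr pair; apply: p_inj.
  by apply: oppr_inj; apply: (addrI (p x)).
rewrite -cardsX; apply: subset_leq_card; apply/fintype.subsetP => w.
case/imsetP => z zAB ->; rewrite inE /= imset_f // andbT.
by move: zAB; rewrite !inE => /andP[/andP[]].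
Qed.

Lemma leq_unit_pairs_r A B :
  (#|unit_pairs A B| <= #|B| * #|unit_differences A B|)%N.
Proof.
rewrite -(card_in_imset (f := fun z => (z.2, difference z))); last first.
  move=> [x y] [x' y'] _ _ /= [<- xy]; congr pair; apply: p_inj.
  exact: (addIr (- p y)).
rewrite -cardsX; apply: subset_leq_card; apply/fintype.subsetP => w.
case/imsetP => z zAB ->; rewrite inE /= imset_f // andbT.
by move: zAB; rewrite !inE => /andP[/andP[]].
Qed.

Lemma card_unit_pairs_split (P U : {set T}) : U \subset P ->
  #|unit_pairs P P| =
    (#|unit_pairs U U| + #|unit_pairs (P :\: U) (P :\: U)|
     + #|unit_pairs U (P :\: U)| + #|unit_pairs (P :\: U) U|)%N.
Proof.
move=> UP.
have cardE A B : #|unit_pairs A B| =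
    (\sum_(x in A) \sum_(y in B) E (p x - p y)%R)%N.
  rewrite pair_big/= -sum1_card big_mkcond [RHS]big_mkcond/=.
  apply: eq_bigr => -[x y] _; rewrite !inE/=.
  by case: (x \in A); case: (y \in B); case: (E _).
have splitU (F : T -> nat) :
    (\sum_(x in P) F x = \sum_(x in U) F x + \sum_(x in P :\: U) F x)%N.
  by rewrite (big_setID U)/= (finset.setIidPr UP).
rewrite !cardE splitU; under eq_bigr => x _ do rewrite splitU.
under [X in (_ + X)%N]eq_bigr => x _ do rewrite splitU.
by rewrite !big_split/=; lia.
Qed.

Variable P : {set T}.

(* A canonical representative in [P] of the class of [x] modulo [zspan S]. *)
Definition rep S (x : T) : T :=
  odflt x [pick y in P | `[< zspan S (p x - p y) >]].

Lemma repP S x : x \in P -> rep S x \in P /\ zspan S (p x - p (rep S x)).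
Proof.
move=> xP; rewrite /rep; case: pickP => [y /andP[yP /asboolP]|/(_ x)]//=.
by rewrite xP/= subrr => /asboolP; have := zspan0 S.
Qed.

Lemma rep_eq S x y : x \in P -> y \in P ->
  zspan S (p x - p y) -> rep S x = rep S y.
Proof.
move=> xP yP xy; have eqxy : (fun z => (z \in P) && `[< zspan S (p x - p z) >])
    =1 (fun z => (z \in P) && `[< zspan S (p y - p z) >]).
  move=> z; congr andb; apply/asboolP/asboolP => h.
    by have := zspanB h xy; rewrite opprB addrC addrA subrK.
  by have := zspanD xy h; rewrite addrA subrK.
rewrite /rep (eq_pick eqxy); case: pickP => //= /(_ y).
by rewrite yP subrr/= => /asboolP; have := zspan0 S.
Qed.

Lemma rep_span S x y : x \in P -> y \in P -> rep S x = rep S y ->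
  zspan S (p x - p y).
Proof.
move=> /(@repP S)[_ xr] /(@repP S)[_ yr] xy; rewrite -xy in yr.
by have := zspanB xr yr; rewrite opprB addrA subrK.
Qed.

(** Makes the classes modulo [v :: S] the image under [rep (v :: S)] of those modulo [S]. *)
Lemma rep_coarse v S x : x \in P -> rep (v :: S) (rep S x) = rep (v :: S) x.
Proof.
move=> xP; have [rP xr] := repP S xP; apply: rep_eq => //.
by rewrite -opprB; apply/zspanN/zspan_cons.
Qed.

End UnitDifferences.

(** * Small generating sets in expanders *)

Section Expander.
Variables (R : realType) (V : zmodType) (E : pred V) (T : finType) (p : T -> V).
Variables (P : {set T}) (l : R).
Hypothesis expand : forall U : {set T}, U != finset.set0 -> U \proper P ->
  l <= #|unit_differences E p U (P :\: U) :|: unit_differences E p (P :\: U) U|%:R.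

Let D := unit_differences E p P P.
Let classes (S : seq V) := rep p P S @: P.

(* Every class of [P] modulo [zspan S] is left by at least [l] of the unit
   differences, so on average one of them leaves a proportion [l / #|D|] of the
   classes; adding it to [S] merges each of these with another class. *)
Lemma merge_step (S : seq V) : (0 < #|D|)%N -> (1 < #|classes S|)%N ->
  exists2 c, c \in D & l * #|classes S|%:R + 2 * #|D|%:R * #|classes (val c :: S)|%:R
    <= 2 * #|D|%:R * #|classes S|%:R.
Proof.
move=> D0 S1; set A := classes S.
pose cl z := [set x in P | rep p P S x == z].
pose Dz z := unit_differences E p (cl z) (P :\: cl z)
  :|: unit_differences E p (P :\: cl z) (cl z).
have clP z : cl z \subset P by apply/fintype.subsetP => x; rewrite inE => /andP[].
have DzD z : Dz z \subset D.
  rewrite finset.subUset; apply/andP; split; apply: finset.imsetS;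
    apply/fintype.subsetP => -[x y]; rewrite !inE /=.
  - by move=> /andP[/andP[/andP[-> _] /andP[_ ->]] ->].
  - by move=> /andP[/andP[/andP[_ ->] /andP[-> _]] ->].
have Dzl z : z \in A -> l <= #|Dz z|%:R.
  move=> zA; apply: expand.
    case/imsetP: zA => x xP ->; apply/finset.set0Pn; exists x.
    by rewrite inE xP eqxx.
  rewrite properE clP /=; apply/negP => /fintype.subsetP Pz.
  move: S1; rewrite -/A (cardsD1 z) zA ltnS => /card_gt0P[w].
  rewrite !inE => /andP[wz /imsetP[x xP wx]].
  by have := Pz _ xP; rewrite inE xP -wx /= (negbTE wz).
(* Double counting the pairs of a class and a difference crossing its boundary yields a [c] that
   crosses at least the average number of boundaries. *)
pose Bc c := [set z in A | c \in Dz z].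
have [c cD hc] : exists2 c, c \in D & l * #|A|%:R <= #|D|%:R * #|Bc c|%:R.
  apply: contrapT => nex.
  have small c : c \in D -> #|Bc c|%:R < l * #|A|%:R / #|D|%:R.
    move=> cD; rewrite ltr_pdivlMr ?ltr0n// mulrC ltNge; apply/negP => h.
    by apply: nex; exists c.
  have sumE : (\sum_(z in A) #|Dz z| = \sum_(c in D) #|Bc c|)%N.
    transitivity (\sum_(z in A) \sum_(c in D) (c \in Dz z))%N.
      apply: eq_bigr => z _; rewrite -sum1_card -(finset.setIidPr (DzD z)).
      rewrite big_mkcond [RHS]big_mkcond; apply: eq_bigr => c _.
      by rewrite finset.in_setI; case: (c \in D); case: (c \in Dz z).
    rewrite exchange_big; apply: eq_bigr => c _; rewrite -sum1_card.
    rewrite big_mkcond [RHS]big_mkcond; apply: eq_bigr => z _.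
    by rewrite [z \in Bc c]inE; case: (z \in A); case: (c \in Dz z).
  have : l * #|A|%:R <= (\sum_(z in A) #|Dz z|)%:R.
    by rewrite natr_sum mulr_natr -sumr_const; apply: ler_sum.
  apply/negP; rewrite -ltNge sumE natr_sum.
  have -> : l * #|A|%:R = \sum_(c in D) l * #|A|%:R / #|D|%:R.
    rewrite sumr_const -[RHS]mulr_natr divfK// pnatr_eq0 -lt0n//.
  apply: ltr_sum => [|c cD]; last exact: small.
  by apply/hasP; case/card_gt0P: D0 => c cD; exists c; rewrite ?mem_index_enum.
exists c => //; set S' := val c :: S.
have AE : classes S' = rep p P S' @: A.
  rewrite /A /classes -imset_comp; apply: eq_in_imset => x xP /=.
  by rewrite rep_coarse.
have memA x : x \in P -> rep p P S x \in A by move=> xP; apply: imset_f.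
have merged x y : x \in P -> y \in P -> p x - p y = val c ->
    rep p P S' (rep p P S x) = rep p P S' (rep p P S y).
  move=> xP yP xy; rewrite !rep_coarse//; apply: rep_eq => //.
  by rewrite xy; exact: zspan_head.
have : (2 * #|classes S'| + #|Bc c| <= 2 * #|A|)%N.
  rewrite AE; apply: leq_card_merge.
    by apply/fintype.subsetP => z; rewrite inE => /andP[].
  move=> z; rewrite inE => /andP[zA]; rewrite inE => /orP[] /imsetP[[x y]];
    rewrite !inE /= => /andP[/andP[]].
  - move=> /andP[xP /eqP xz] /andP[yz yP] _ /(congr1 val)/esym/= xy.
    rewrite yP /= in yz; exists (rep p P S y); split=> //; first exact: memA.
    by rewrite -xz; apply/esym; exact: merged.
  - move=> /andP[xz xP] /andP[yP /eqP yz] _ /(congr1 val)/esym/= xy.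
    rewrite xP /= in xz; exists (rep p P S x); split=> //; first exact: memA.
    by rewrite -yz; exact: merged.
rewrite -(ler_nat R) natrD !natrM => hm.
have : #|D|%:R * (2 * #|classes S'|%:R + #|Bc c|%:R) <= #|D|%:R * (2 * #|A|%:R) :> R.
  by rewrite ler_wpM2l.
by move: hc; lra.
Qed.

(** As long as two classes remain, a step multiplies their number by at most [1 - l / (2 #|D|)]; the
    [max] with 1 covers an early stop. *)
Lemma merge_iter (j : nat) : (0 < #|D|)%N -> l <= #|D|%:R *+ 2 ->
  exists S : seq V, [/\ (size S <= j)%N, all E S &
    #|classes S|%:R <= Num.max 1 (#|P|%:R * (1 - l / (#|D|%:R *+ 2)) ^+ j)].
Proof.
move=> D0 lD; elim: j => [|j [S [Sj ES hS]]].
  by exists [::]; rewrite expr0 mulr1 le_max ler_nat leq_imset_card orbT.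
have [S1|S1] := leqP #|classes S| 1.
  by exists S; split=> //; [exact: leqW | rewrite le_max lern1 S1].
have [c cD hc] := merge_step D0 S1; exists (val c :: S); split => //=.
  rewrite ES andbT; case/imsetP: cD => z + ->; rewrite inE => /andP[_].
  by [].
have D0' : 0 < #|D|%:R *+ 2 :> R by rewrite pmulrn_lgt0 ?ltr0n.
set x := l / _; have x1 : x <= 1 by rewrite ler_pdivrMr ?mul1r.
move: hS; rewrite le_max lern1 leqNgt S1 /= => hS.
rewrite le_max exprSr mulrA; apply/orP; right.
apply: (@le_trans _ _ (#|classes S|%:R * (1 - x))); last first.
  by rewrite ler_wpM2r// subr_ge0.
rewrite mulrBr mulr1 /x mulrA lerBrDr -(@ler_pM2l _ (#|D|%:R *+ 2))//.
rewrite mulrDr [X in _ + X]mulrC divfK ?gt_eqF//.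
by move: hc; rewrite !mulr_natl; lra.
Qed.

(** The cut around a single point is crossed by [l] differences, all in [D]. *)
Lemma expand_le_card : (1 < #|P|)%N -> l <= #|D|%:R.
Proof.
move=> P1.
have [x xP] : exists x, x \in P by apply/card_gt0P; lia.
have xP1 : [set x] \proper P.
  rewrite properEcard cards1 P1 andbT; apply/fintype.subsetP => y.
  by rewrite inE => /eqP ->.
apply: le_trans (expand _ xP1) _.
  by apply/finset.set0Pn; exists x; rewrite inE.
rewrite ler_nat; apply: subset_leq_card.
rewrite finset.subUset; apply/andP; split; apply: finset.imsetS;
  apply/fintype.subsetP => -[y z]; rewrite !inE /=.
- by move=> /andP[/andP[/eqP-> /andP[_ ->]] ->]; rewrite xP.
- by move=> /andP[/andP[/andP[_ ->] /eqP->] ->]; rewrite xP.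
Qed.

Lemma small_generating_set : 0 < l -> (1 < #|P|)%N ->
  exists S : seq V, [/\ (size S)%:R <= 2 * #|D|%:R * ln #|P|%:R / l + 1, all E S &
    forall x y, x \in P -> y \in P -> zspan S (p x - p y)].
Proof.
move=> l0 P1.
have lD := expand_le_card P1.
have D0 : (0 < #|D|)%N by rewrite -(ltr0n R); exact: lt_le_trans lD.
have D0' : 0 < #|D|%:R :> R by rewrite ltr0n.
have lnP : 0 < ln #|P|%:R :> R by rewrite ln_gt0// ltr1n.
have q0 : 0 <= 2 * #|D|%:R * ln #|P|%:R / l.
  by rewrite ltW// divr_gt0// !mulr_gt0.
(* [j + 1] steps suffice: with [x = l / (2 #|D|)], [(1 - x) ^ (j + 1) <= exp (- x (j + 1)) <= 1 /
   #|P|], which leaves one class. *)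
have := truncn_itv q0; set j := Num.truncn _ => /andP[j1 j2].
have l2D : l <= #|D|%:R *+ 2 by rewrite mulr2n ler_wpDr.
have [S [Sj ES hS]] := merge_iter j.+1 D0 l2D.
exists S; split=> //.
  by apply: le_trans (_ : j.+1%:R <= _); rewrite ?ler_nat// -natr1 lerD2r.
have : #|classes S|%:R <= 1 :> R.
  apply: le_trans hS _; rewrite ge_max lexx /=.
  have x1 : l / (#|D|%:R *+ 2) <= 1 by rewrite ler_pdivrMr ?mul1r// pmulrn_lgt0.
  apply: (@le_trans _ _ (#|P|%:R * expR (- ln #|P|%:R))); last first.
    by rewrite expRN lnK ?posrE ?ltr0n ?mulfV ?pnatr_eq0//; lia.
  rewrite ler_wpM2l//.
  apply: (@le_trans _ _ (expR (- (l / (#|D|%:R *+ 2))) ^+ j.+1)).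
    by rewrite lerXn2r ?nnegrE ?subr_ge0 ?expR_ge0// expR_ge1Dx.
  rewrite -expRM_natl ler_expR mulrN lerN2 -ler_pdivrMr ?divr_gt0 ?pmulrn_lgt0//.
  apply: le_trans (ltW j2).
  rewrite le_eqVlt; apply/orP; left; apply/eqP; rewrite -mulr_natl; field.
  by rewrite !gt_eqF.
rewrite lern1 => S1 x y xP yP; apply: (rep_span xP yP).
by apply: (card_le1_eqP S1); exact: imset_f.
Qed.

End Expander.

(** * Few unit distances *)

Section FewUnitPairs.
Variable R : realType.

Lemma half_le_ln2 : 2^-1 <= ln 2 :> R.
Proof.
rewrite -(expRK 2^-1) ler_ln ?posrE ?expR_gt0//.
have := @expR_ge1Dx R (- 2^-1); rewrite expRN => h.
by rewrite -[leLHS]invrK -[leRHS]invrK lef_pV2 ?posrE ?invr_gt0 ?expR_gt0//; lra.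
Qed.

(** [s ln s + s ln 2 = s ln (2 s)], and both [2 s] and [t] are at most [s + t]. *)
Lemma xlnx_superadditive (s t : nat) : (0 < s)%N -> (s <= t)%N ->
  s%:R * ln s%:R + t%:R * ln t%:R + s%:R * ln 2
  <= (s + t)%:R * ln (s + t)%:R :> R.
Proof.
move=> s0 st; have t0 : (0 < t)%N by lia.
have -> : s%:R * ln s%:R + t%:R * ln t%:R + s%:R * ln 2
    = s%:R * ln (2 * s)%:R + t%:R * ln t%:R :> R.
  by rewrite natrM lnM ?posrE ?ltr0n//; ring.
rewrite [X in _ <= X * _]natrD mulrDl.
by apply: lerD; rewrite ler_wpM2l// ler_ln ?posrE ?ltr0n// ?ler_nat; lia.
Qed.

Variables (V : zmodType) (E : pred V) (B : nat).
Hypothesis B_gt0 : (0 < B)%N.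
Hypothesis E0 : ~~ E 0.
Hypothesis few_in_zspan : forall S W : seq V, all E S -> all E W -> uniq W ->
  (forall w, w \in W -> zspan S w) -> (size W <= B * size S)%N.

Variables (T : finType) (p : T -> V).
Hypothesis p_inj : injective p.

(* A counterexample of least cardinality expands: by superadditivity of
   [x ln x] every cut is crossed by many unit differences. *)
Lemma few_unit_pairs (n : nat) (P : {set T}) : (1 < n)%N -> (#|P| <= n)%N ->
  #|unit_pairs E p P P|%:R <= 24 * B%:R * ln n%:R * (#|P|%:R * ln #|P|%:R) :> R.
Proof.
move=> n1.
have small (U : {set T}) : (#|U| <= 1)%N -> #|unit_pairs E p U U|%:R
    <= 24 * B%:R * ln n%:R * (#|U|%:R * ln #|U|%:R) :> R.
  move=> U1; have -> : unit_pairs E p U U = finset.set0.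
    apply/setP => z; rewrite !inE; apply/negP => /andP[/andP[zU1 zU2]].
    by rewrite (card_le1_eqP U1 _ _ zU1 zU2) subrr; exact/negP.
  by rewrite cards0; move: U1; case: #|U| => [|[|//]] _; rewrite ?ln1 ?mul0r !mulr0.
(* Induction on a bound [m] for [#|P|], with [n] and hence the constant [K] fixed. *)
move: {2}#|P| (leqnn #|P|) => m; elim: m P => [|m IHm] P Pm Pn.
  by apply: small; exact: leq_trans Pm _.
have [/small//|P1] := leqP #|P| 1.
have lnn : 2^-1 <= ln n%:R :> R.
  by rewrite (le_trans half_le_ln2)// ler_ln ?posrE ?ltr0n// ?ler_nat; lia.
have B0 : 1 <= B%:R :> R by rewrite ler1n.
set K : R := 24 * B%:R * ln n%:R.
have K0 : 0 < K by rewrite !mulr_gt0//; lra.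
rewrite leNgt; apply/negP => big.
(* Minimality puts more than [K s ln 2] unit pairs across the cut, [s] being the size of the smaller
   side; each difference accounts for at most [s] pairs in each direction, so at least
   [K ln 2 / 2 >= 6 B ln n] differences occur. *)
have expand (U : {set T}) : U != finset.set0 -> U \proper P ->
    6 * B%:R * ln n%:R <=
    #|unit_differences E p U (P :\: U) :|: unit_differences E p (P :\: U) U|%:R :> R.
  move=> U0 UP; set W := P :\: U; set DU := _ :|: _.
  have UsP := proper_sub UP.
  have PE : #|P| = (#|U| + #|W|)%N.
    by rewrite -(cardsID U P) (finset.setIidPr UsP).
  have Ugt0 : (0 < #|U|)%N by rewrite card_gt0.
  have Wgt0 : (0 < #|W|)%N by have := proper_card UP; lia.
  have bU : #|unit_pairs E p U U|%:R <= K * (#|U|%:R * ln #|U|%:R).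
    by apply: IHm; lia.
  have bW : #|unit_pairs E p W W|%:R <= K * (#|W|%:R * ln #|W|%:R).
    by apply: IHm; lia.
  set s := minn #|U| #|W|.
  have cross A A' : unit_differences E p A A' \subset DU ->
      (s = minn #|A| #|A'|) -> #|unit_pairs E p A A'|%:R <= s%:R * #|DU|%:R :> R.
    move=> AD sA; rewrite -natrM ler_nat sA.
    have h1 := leq_unit_pairs_l E p_inj A A'.
    have h2 := leq_unit_pairs_r E p_inj A A'.
    have h3 := subset_leq_card AD.
    have [_|_] := leqP #|A| #|A'|; last first.
      by rewrite (leq_trans h2)// leq_mul2l h3 orbT.
    by rewrite (leq_trans h1)// leq_mul2l h3 orbT.
  have c1 := cross U W (finset.subsetUl _ _) erefl.
  have c2 := cross W U (finset.subsetUr _ _) (minnC _ _).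
  have sup : #|U|%:R * ln #|U|%:R + #|W|%:R * ln #|W|%:R + s%:R * ln 2
      <= #|P|%:R * ln #|P|%:R :> R.
    rewrite PE /s; have [UW|/ltnW WU] := leqP #|U| #|W|.
      exact: xlnx_superadditive.
    by rewrite addnC [X in X + _]addrC; exact: xlnx_superadditive.
  have s0 : 0 < s%:R :> R by rewrite ltr0n leq_min Ugt0.
  move: big; rewrite (card_unit_pairs_split E p UsP) !natrD => big.
  have := ler_wpM2l (ltW K0) sup; rewrite !mulrDr => Ksup.
  have : K * (s%:R * ln 2) <= s%:R * #|DU|%:R *+ 2 by lra.
  rewrite mulrCA -mulrnAr ler_pM2l// => h.
  have := ler_wpM2l (ltW K0) half_le_ln2; rewrite /K in h *.
  by lra.
set l : R := 6 * B%:R * ln n%:R in expand.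
have l0 : 0 < l by rewrite !mulr_gt0//; lra.
set D := unit_differences E p P P.
have lD : l <= #|D|%:R := expand_le_card expand P1.
have [S [Ss ES PS]] := small_generating_set expand l0 P1.
rewrite -/D in Ss.
have DP c : c \in D -> E (val c) /\ zspan S (val c).
  case/imsetP => -[x y]; rewrite !inE /= => /andP[/andP[xP yP] Exy] -> /=.
  by split=> //; exact: PS.
(* All of [D] lies in [zspan S], so [#|D| <= B (2 #|D| ln #|P| / l + 1) <= #|D| / 3 + B]; this
   contradicts [#|D| >= l >= 3 B]. *)
have : (#|D| <= B * size S)%N.
  have -> : #|D| = size [seq val c | c <- enum D] by rewrite size_map -cardE.
  apply: few_in_zspan => //.
  - by apply/allP => _ /mapP[c + ->]; rewrite mem_enum => /DP[].
  - by rewrite (map_inj_uniq val_inj) enum_uniq.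
  - by move=> _ /mapP[c + ->]; rewrite mem_enum => /DP[].
rewrite -(ler_nat R) natrM => DS.
have : #|D|%:R <= B%:R * (2 * #|D|%:R * ln #|P|%:R / l + 1).
  by rewrite (le_trans DS)// ler_wpM2l.
have : B%:R * (2 * #|D|%:R * ln #|P|%:R / l + 1) <= #|D|%:R / 3 + B%:R :> R.
  rewrite mulrDr mulr1 lerD2r.
  have -> : #|D|%:R / 3 = B%:R * (2 * #|D|%:R * ln n%:R / l) :> R.
    by rewrite /l; field; rewrite gt_eqF ?gt_eqF//; lra.
  have li0 : 0 <= l^-1 by rewrite invr_ge0 ltW.
  rewrite ler_wpM2l// ler_wpM2r// ler_wpM2l//.
  by rewrite ler_ln ?posrE ?ltr0n// ?ler_nat; lia.
have : 3 * B%:R <= l by rewrite /l; nra.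
by lra.
Qed.

End FewUnitPairs.

(** * The space of norms *)

Section Dot.
Variables (R : realType) (d : nat).
Implicit Types (g x y : 'rV[R]_d).

Definition dot g x : R := \sum_i g 0 i * x 0 i.

Lemma dotDr g x y : dot g (x + y) = dot g x + dot g y.
Proof. by rewrite -big_split; apply: eq_bigr => i _; rewrite mxE mulrDr. Qed.

Lemma dotZr g a x : dot g (a *: x) = a * dot g x.
Proof. by rewrite mulr_sumr; apply: eq_bigr => i _; rewrite mxE mulrCA. Qed.

Lemma dotNr g x : dot g (- x) = - dot g x.
Proof. by rewrite -scaleN1r dotZr mulN1r. Qed.

Lemma enormZ a x : enorm (a *: x) = `|a| * enorm x.
Proof.
rewrite /enorm -sqrtr_sqr -sqrtrM ?sqr_ge0// mulr_sumr; congr Num.sqrt.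
by apply: eq_bigr => i _; rewrite mxE exprMn.
Qed.

Lemma norm_dot_le g x : `|dot g x| <= enorm g * enorm x.
Proof.
rewrite ler_norml ler_dot_enorm andbT lerNl -dotNr.
by apply: le_trans (ler_dot_enorm _ _) _; rewrite enormN.
Qed.

Lemma enorm_gt0 x : x != 0 -> 0 < enorm x.
Proof.
move=> x0; rewrite lt_neqAle enorm_ge0 andbT eq_sym.
by apply: contra x0 => /eqP/enorm_eq0 ->.
Qed.

Lemma sqr_enormB x y :
  enorm (x - y) ^+ 2 = enorm x ^+ 2 + enorm y ^+ 2 - 2 * dot y x.
Proof.
rewrite !sqr_enorm mulr_sumr -big_split -sumrB; apply: eq_bigr => i _.
by rewrite !mxE /=; ring.
Qed.

Lemma enorm_le_sum x : enorm x <= \sum_i `|x 0 i|.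
Proof.
have s0 : 0 <= \sum_i `|x 0 i| by apply: sumr_ge0.
rewrite -(@ler_pXn2r _ 2)// ?nnegrE ?enorm_ge0// sqr_enorm expr2 mulr_suml.
apply: ler_sum => i _; rewrite -real_normK ?num_real// expr2 ler_wpM2l//.
by rewrite (bigD1 i)//= lerDl sumr_ge0.
Qed.

Lemma ler_enorm_sum (I : Type) (r : seq I) (F : I -> 'rV[R]_d) :
  enorm (\sum_(i <- r) F i) <= \sum_(i <- r) enorm (F i).
Proof.
elim/big_ind2: _ => [|a b x y ab xy|//]; first by rewrite enorm0.
by rewrite (le_trans (ler_enormD _ _))// lerD.
Qed.

Lemma enorm_le_mxnorm x : enorm x <= d%:R * `|x|.
Proof.
apply: le_trans (enorm_le_sum x) _; rewrite -[X in X%:R * _](card_ord d).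
by rewrite mulr_natl -sumr_const ler_sum// => i _; exact: coord_le_norm.
Qed.

(** Compactness: the open caps [1 - tau < dot g x] centred on the sphere cover it. *)
Lemma sphere_net (tau : R) : 0 < tau ->
  exists (I : finType) (g : I -> 'rV[R]_d), (forall i, enorm (g i) = 1) /\
    forall x, x != 0 -> exists i, (1 - tau) * enorm x <= dot (g i) x.
Proof.
move=> tau0; pose K : set 'rV[R]_d := [set x | enorm x = 1]%classic.
have dot_cont g : continuous (dot g : 'rV[R]_d -> R).
  apply: (@continuous_big R 'I_d +%R 0 predT (@add_continuous R)).
  move=> i _ x; apply: (@continuousM _ _ (fun=> g 0 i) (fun x : 'rV[R]_d => x 0 i)).
    exact: cst_continuous.
  exact: coord_continuous.
have cK : compact K.
  apply: bounded_closed_compact.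
    exists 1; split; first exact: num_real.
    move=> r r1 x /= x1; rewrite [leLHS]mx_normrE; apply/bigmax_leP; split.
      by rewrite ltW// (lt_trans ltr01).
    move=> [i j] _ /=; rewrite ord1 (le_trans (ler_coord_enorm x j))// x1.
    exact: ltW.
  have -> : K = ((DNorm (@ler_enormD R d) enormZ (@enorm_eq0 R d)) @^-1` [set 1])%classic.
    by [].
  by apply: closed_comp; [move=> x _; exact: dnorm_continuous | exact: closed_eq].
move: (cK); rewrite compact_cover => /(_ 'rV[R]_d K
  (fun g => [set x | 1 - tau < dot g x]%classic))[].
- move=> g _; rewrite [X in open X](_ : _ = (dot g @^-1` [set t | 1 - tau < t])%classic)//.
  by apply: open_comp; [move=> x _; exact: dot_cont | exact: open_gt].
- move=> x /= x1; exists x => //=; have := sqr_enorm x; rewrite x1 expr1n.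
  by rewrite /dot => e1; under eq_bigr do rewrite -expr2; rewrite -e1; lra.
move=> D DK KD; exists D, val; split.
  by move=> [g gD] /=; have := DK _ gD; rewrite inE.
move=> x x0; have ex := enorm_gt0 x0.
have [|g gD /= gx] := KD ((enorm x)^-1 *: x).
  by rewrite /K /= enormZ normfV gtr0_norm// mulVf// gt_eqF.
exists [` gD]%fset => /=; rewrite dotZr in gx.
by rewrite -ler_pdivlMr// mulrC ltW.
Qed.

End Dot.

(** * Hausdorff distance and values of norms *)

Section DnormDist.
Variables (R : realType) (d : nat).
Implicit Types (N M : dnorm R d) (x : 'rV[R]_d).

Lemma dnorm_equiv_enorm N : exists c C : R, [/\ 0 < c, 0 < C &
  forall x, c * enorm x <= N x /\ N x <= C * enorm x].
Proof.
have [c0 c00 hc] := norm_le_dnorm N.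
set C0 := \sum_i N (delta_mx 0 i).
have C00 : 0 <= C0 by apply: sumr_ge0 => i _; exact: dnorm_ge0.
have d1 : 0 < d%:R + 1 :> R by rewrite ltr_wpDl.
exists (c0 / (d%:R + 1)), (C0 + 1); split; [exact: divr_gt0| by rewrite ltr_wpDl|].
move=> x; split.
  apply: le_trans (hc x); rewrite -mulrA ler_pM2l// mulrC ler_pdivrMr//.
  apply: le_trans (enorm_le_mxnorm x) _.
  by rewrite mulrDr mulr1 mulrC lerDl.
apply: le_trans (dnorm_le_enorm N x) _.
by rewrite ler_wpM2r ?enorm_ge0// lerDl.
Qed.

(** The ball of [M] lies in that of [N]; conversely, dividing a point of the ball of [N] by
    [1 + e / c] brings it into the ball of [M] and moves it by at most [(e / c) c^-1]. *)
Lemma dnorm_dist_le N M (c e : R) : 0 < c -> 0 <= e ->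
  (forall x, c * enorm x <= N x) ->
  (forall x, N x <= M x /\ M x <= N x + e * enorm x) ->
  dnorm_dist N M <= e / c ^+ 2.
Proof.
move=> c0 e0 cN NM; have ec0 : 0 <= e / c by rewrite divr_ge0// ltW.
have radius : 0 <= e / c ^+ 2 by rewrite divr_ge0// sqr_ge0.
apply: ge_inf; first exact: hausdorff_radii_lb.
split=> // x; last first.
  move=> Mx; exists x; last by rewrite subrr enorm0.
  by apply: le_trans Mx; exact: (NM x).1.
move=> Nx; have k0 : 0 < 1 + e / c by rewrite ltr_pwDl.
have xc : enorm x <= c^-1.
  by rewrite -[leRHS]mul1r ler_pdivlMr// mulrC (le_trans (cN x)).
exists ((1 + e / c)^-1 *: x).
  rewrite /unit_ball /= dnormZ normfV gtr0_norm// mulrC ler_pdivrMr// mul1r.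
  by rewrite (le_trans (NM x).2)// lerD// ler_wpM2l.
rewrite -[X in X - _]scale1r -scalerBl enormZ.
have -> : 1 - (1 + e / c)^-1 = e / c / (1 + e / c).
  by field; rewrite !gt_eqF//= ltr_pwDl.
have [c0' k0'] := (ltW c0, ltW k0).
rewrite ger0_norm ?divr_ge0//.
apply: (@le_trans _ _ (e / c * c^-1)); last by rewrite expr2 invfM mulrA.
apply: ler_pM => //; first by rewrite !divr_ge0.
  exact: enorm_ge0.
by rewrite ler_pdivrMr// ler_peMr// lerDl.
Qed.

(** The bound involves a constant of [N] only, because [M] will range over all norms near [N]. For
    the lower estimate, [s] is the supremum of [M] on the unit ball of [N], so that [M <= s N]. *)
Lemma dnorm_dist_near N M (C r : R) x : 0 < C -> C * r <= 2^-1 ->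
  (forall x, N x <= C * enorm x) -> dnorm_dist N M < r -> M x = 1 ->
  `|N x - 1| <= 2 * (C * r).
Proof.
move=> C0 Cr NC NMr Mx.
have [r' [r'0 NM MN] rr'] : exists2 r', hausdorff_radii (unit_ball N) (unit_ball M) r'
    & r' < r.
  have := NMr; rewrite -subr_gt0 => /inf_adherent.
  have hi : has_inf (hausdorff_radii (unit_ball N) (unit_ball M)).
    by split; [exact: unit_ball_radii | exact: hausdorff_radii_lb].
  by move=> /(_ _ hi)[r' hr']; rewrite addrCA subrr addr0; exists r'.
have Cr' : C * r' <= C * r by rewrite ler_pM2l// ltW.
have r0 : 0 < r by exact: le_lt_trans rr'.
have Cr0 : 0 < C * r by exact: mulr_gt0.
have upper : N x <= 1 + C * r.
  have [|y Ny xy] := MN x; first by rewrite /unit_ball /= Mx.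
  rewrite -(subrK y x) addrC (le_trans (ler_dnormD _ _ _))// lerD//.
  by rewrite (le_trans (NC _))// (le_trans _ Cr')// ler_pM2l.
have [cM [CM [_ CM0 hM]]] := dnorm_equiv_enorm M.
have [cN [CN [cN0 _ hN]]] := dnorm_equiv_enorm N.
pose A := [set M y | y in unit_ball N]%classic.
have supA : has_sup A.
  split; first by exists (M 0), 0 => //; exact: unit_ball0.
  exists (CM / cN) => _ [y Ny <-]; apply: le_trans (hM y).2 _.
  rewrite ler_pM2l// -[leRHS]mul1r ler_pdivlMr// mulrC.
  exact: le_trans (hN y).1 Ny.
set s := sup A.
have MsN y : M y <= s * N y.
  have [->|y0] := eqVneq y 0; first by rewrite !dnorm0 mulr0.
  have Ny0 := dnorm_gt0 N y0.
  rewrite -ler_pdivrMr// mulrC -(gtr0_norm Ny0) -normfV -dnormZ.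
  apply: ub_le_sup; first exact: supA.2.
  exists ((N y)^-1 *: y) => //.
  by rewrite /unit_ball /= dnormZ normfV gtr0_norm// mulVf// gt_eqF.
have s0 : 0 <= s.
  by apply: ub_le_sup; [exact: supA.2 | exists 0; [exact: unit_ball0 | exact: dnorm0]].
(* Each [y] in the ball of [N] is near a [z] in that of [M], and
   [M (y - z) <= s N (y - z) <= s C r]; hence [s <= 1 + 2 C r]. *)
have sle : s <= 1 + s * (C * r).
  apply: ge_sup; first exact: supA.1.
  move=> _ [y Ny <-]; have [z Mz yz] := NM _ Ny.
  rewrite -(subrK z y) addrC (le_trans (ler_dnormD _ _ _))// lerD//.
  rewrite (le_trans (MsN _))// ler_wpM2l// (le_trans (NC _))//.
  by rewrite (le_trans _ Cr')// ler_pM2l.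
have := MsN x; rewrite Mx => sN.
rewrite ler_norml; apply/andP; split; last by lra.
have s2 : s <= 1 + 2 * (C * r) by nra.
have : 1 <= (1 + 2 * (C * r)) * N x.
  by rewrite (le_trans sN)// ler_wpM2r// dnorm_ge0.
by nra.
Qed.

End DnormDist.

(** * Generic perturbations *)

Section Pigeonhole.

(** Values on [J] are prescribed, which leaves at most [#|G| ^ (#|I| - #|J|)] functions; the product
    form avoids the subtraction. *)
Lemma card_agreeing_ffuns (I G : finType) (X : {set {ffun I -> G}}) (J : {set I}) :
  (forall h h', h \in X -> h' \in X -> forall i, i \in J -> h i = h' i) ->
  (#|X| * #|G| ^ #|J| <= #|G| ^ #|I|)%N.
Proof.
move=> agree; have [->|/finset.set0Pn[h0 h0X]] := eqVneq X finset.set0.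
  by rewrite cards0.
pose F i : pred G := if i \in J then pred1 (h0 i) else predT.
have XF : (#|X| <= #|family F|)%N.
  apply: subset_leq_card; apply/fintype.subsetP => h hX; apply/familyP => i.
  rewrite /F; case: ifPn => // iJ; rewrite inE.
  by apply/eqP; exact: agree.
rewrite (leq_trans (leq_mul XF (leqnn _)))// card_family.
have -> : foldr muln 1%N [seq #|F x| | x : I] = (\prod_i #|F i|)%N.
  by rewrite foldrE big_map big_enum.
rewrite -prod_nat_const -[X in (_ <= X)%N]prod_nat_const [X in (_ * X)%N]big_mkcond.
rewrite -big_split/= leq_prod// => i _; rewrite /F.
by case: (i \in J); rewrite ?card1 ?mul1n ?muln1.
Qed.

(** [(c, s)] is a code that determines [h] on the image of [s], which has at least [r] points; so
    each code serves at most [#|G| ^ (#|I| - r)] functions, and all [#|G| ^ #|I|] of them have a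
    code. *)
Lemma pigeonhole_ffuns (I C J G : finType) (r : nat)
    (Q : {ffun I -> G} -> C -> {ffun J -> I} -> Prop) :
  (0 < #|G|)%N ->
  (forall h, exists c s, Q h c s) ->
  (forall h c s, Q h c s -> (r <= #|[set s j | j : J]|)%N) ->
  (forall h h' c s, Q h c s -> Q h' c s -> forall j, h (s j) = h' (s j)) ->
  (#|G| ^ r <= #|C| * #|I| ^ #|J|)%N.
Proof.
move=> G0 ex img det.
pose X (w : C * {ffun J -> I}) := [set h | `[< Q h w.1 w.2 >]].
have XG w : (#|X w| * #|G| ^ r <= #|G| ^ #|I|)%N.
  have [->|/finset.set0Pn[h0]] := eqVneq (X w) finset.set0; first by rewrite cards0.
  rewrite inE => /asboolP/img wr.
  apply: (@leq_trans (#|X w| * #|G| ^ #|[set w.2 j | j : J]|)%N).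
    by rewrite leq_mul2l leq_pexp2l ?orbT.
  apply: card_agreeing_ffuns.
  move=> h h'; rewrite [h \in _]inE [h' \in _]inE => /asboolP Qh /asboolP Qh' _ /imsetP[j _ ->].
  exact: det Qh Qh' j.
have all : (#|G| ^ #|I| <= \sum_w #|X w|)%N.
  have -> : (#|G| ^ #|I| = #|[set: {ffun I -> G}]|)%N by rewrite cardsT card_ffun.
  apply: leq_trans (_ : #|\bigcup_w X w| <= _)%N; last first.
    elim/big_ind2: _ => [|x1 n1 x2 n2 h1 h2|//]; first by rewrite cards0.
    by apply: leq_trans (leq_card_setU _ _) _; exact: leq_add.
  apply: subset_leq_card; apply/fintype.subsetP => h _.
  have [c [s Qh]] := ex h; apply/bigcupP; exists (c, s) => //.
  by rewrite inE; exact/asboolP.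
have GI : (0 < #|G| ^ #|I|)%N by rewrite expn_gt0 G0.
rewrite -(leq_pmul2l GI) (leq_trans (leq_mul all (leqnn _)))// big_distrl/=.
apply: leq_trans (_ : \sum_(w : C * {ffun J -> I}) #|G| ^ #|I| <= _)%N.
  exact: leq_sum.
by rewrite sum_nat_const card_prod card_ffun mulnC.
Qed.

End Pigeonhole.

(** * Polyhedral perturbations of a norm *)

Section MaxDot.
Variables (R : realType) (d : nat) (I : finType) (g : I -> 'rV[R]_d).
Variable h : I -> R.
Hypothesis h_ge0 : forall i, 0 <= h i.
Implicit Types x y : 'rV[R]_d.

Definition max_dot x : R := \big[Num.max/0]_i (h i * `|dot (g i) x|).

Lemma max_dot_ge i x : h i * `|dot (g i) x| <= max_dot x.
Proof. by apply/bigmax_geP; right; exists i. Qed.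

Lemma max_dot_ge0 x : 0 <= max_dot x.
Proof. by apply/bigmax_geP; left. Qed.

Lemma max_dot_leP x r : 0 <= r -> (forall i, h i * `|dot (g i) x| <= r) ->
  max_dot x <= r.
Proof. by move=> r0 hr; apply/bigmax_leP; split=> // i _; exact: hr. Qed.

Lemma max_dotD x y : max_dot (x + y) <= max_dot x + max_dot y.
Proof.
apply: max_dot_leP => [|i]; first by rewrite addr_ge0 ?max_dot_ge0.
rewrite dotDr (@le_trans _ _ (h i * (`|dot (g i) x| + `|dot (g i) y|)))//.
  by rewrite ler_wpM2l// ler_normD.
by rewrite mulrDr lerD ?max_dot_ge.
Qed.

Lemma max_dotZ a x : max_dot (a *: x) = `|a| * max_dot x.
Proof.
have le b y : max_dot (b *: y) <= `|b| * max_dot y.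
  apply: max_dot_leP => [|i]; first by rewrite mulr_ge0 ?max_dot_ge0.
  by rewrite dotZr normrM mulrCA ler_wpM2l// max_dot_ge.
apply/le_anti; rewrite le /=; have [->|a0] := eqVneq a 0.
  by rewrite normr0 mul0r max_dot_ge0.
have := le a^-1 (a *: x); rewrite scalerA mulVf// scale1r => h'.
have na : 0 < `|a| by rewrite normr_gt0.
by rewrite -ler_pdivlMl// -normfV.
Qed.

Lemma max_dot_attained (i0 : I) x : exists i, max_dot x = h i * `|dot (g i) x|.
Proof.
rewrite /max_dot; have [|i _ ->] := @eq_bigmax _ _ _ (0 : R) i0 predT (fun i => h i * `|dot (g i) x|) erefl.
  by move=> i _; rewrite mulr_ge0.
by exists i.
Qed.

Variables (N : dnorm R d) (e : R).
Hypothesis e_ge0 : 0 <= e.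

Let pnorm x := N x + e * max_dot x.

Let pnormD x y : pnorm (x + y) <= pnorm x + pnorm y.
Proof.
rewrite /pnorm addrACA lerD ?ler_dnormD// -mulrDr ler_wpM2l//.
exact: max_dotD.
Qed.

Let pnormZ a x : pnorm (a *: x) = `|a| * pnorm x.
Proof. by rewrite /pnorm dnormZ max_dotZ; ring. Qed.

Let pnorm0_eq0 x : pnorm x = 0 -> x = 0.
Proof.
move=> x0; apply: (@dnorm0_eq0 _ _ N); apply/le_anti; rewrite dnorm_ge0 andbT.
by rewrite -x0 /pnorm lerDl mulr_ge0// max_dot_ge0.
Qed.

Definition perturbed : dnorm R d := DNorm pnormD pnormZ pnorm0_eq0.

End MaxDot.

Section Perturbation.
Variables (R : realType) (d : nat).
Implicit Types (N : dnorm R d) (x y g : 'rV[R]_d).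

(** In Euclidean norms, [|x - |x| g|^2 = 2 |x|^2 - 2 |x| dot g x <= 4 tau |x|^2]. *)
Lemma enorm_sub_ray (tau s : R) g x : enorm g = 1 -> 0 <= s -> 4 * tau <= s ^+ 2 ->
  (1 - 2 * tau) * enorm x <= dot g x -> enorm (x - enorm x *: g) <= s * enorm x.
Proof.
move=> g1 s0 ts gx; have x0 := enorm_ge0 x.
rewrite -(@ler_pXn2r _ 2)// ?nnegrE ?enorm_ge0 ?mulr_ge0// sqr_enormB enormZ g1.
rewrite ger0_norm// mulr1.
have -> : dot (enorm x *: g) x = enorm x * dot g x.
  by rewrite /dot mulr_sumr; apply: eq_bigr => i _; rewrite mxE mulrA.
have h1 := ler_wpM2l x0 gx.
have h2 := ler_wpM2l (sqr_ge0 (enorm x)) ts.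
by rewrite exprMn; nra.
Qed.

(** Both vectors are near the ray of [g], so [N x] and [N y] are near [|x| N g] and [|y| N g]; since
    both values are near 1, the lengths nearly agree, and so do the vectors. *)
Lemma same_cap_close N (c C tau s del : R) g x y :
  0 < c -> 0 < C -> (forall x, c * enorm x <= N x /\ N x <= C * enorm x) ->
  enorm g = 1 -> 0 <= s -> 4 * tau <= s ^+ 2 ->
  (1 - 2 * tau) * enorm x <= dot g x -> (1 - 2 * tau) * enorm y <= dot g y ->
  `|N x - 1| <= del -> `|N y - 1| <= del ->
  enorm x <= 2 / c -> enorm y <= 2 / c ->
  enorm (x - y) <= s * (4 / c) + (2 * del + C * (s * (4 / c))) / c.
Proof.
move=> c0 C0 NE g1 s0 ts gx gy Nx Ny xc yc.
have hx := enorm_sub_ray g1 s0 ts gx; have hy := enorm_sub_ray g1 s0 ts gy.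
set a := enorm x in hx xc *; set b := enorm y in hy yc *.
have sab : s * (a + b) <= s * (4 / c).
  by rewrite ler_wpM2l//; move: xc yc; lra.
have ng : c <= N g by have := (NE g).1; rewrite g1 mulr1.
have tri : enorm (x - y) <= enorm (x - a *: g) + (`|a - b| + enorm (y - b *: g)).
  have -> : x - y = (x - a *: g) + ((a - b) *: g - (y - b *: g)).
    by rewrite scalerBl opprB; apply/rowP => i; rewrite !mxE; ring.
  rewrite (le_trans (ler_enormD _ _))// lerD// (le_trans (ler_enormD _ _))//.
  by rewrite enormN enormZ g1 mulr1.
have close z k : enorm (z - k *: g) <= s * k -> 0 <= k ->
    `|N z - k * N g| <= C * (s * k).
  move=> zk k0; rewrite -[in k * _](ger0_norm k0) -dnormZ.
  rewrite (le_trans (ler_dnormB _ _ _))// (le_trans (NE _).2)//.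
  by rewrite ler_pM2l.
have {}hx' := close _ _ hx (enorm_ge0 x); have hy' := close _ _ hy (enorm_ge0 y).
have abN : `|a - b| * N g <= 2 * del + C * (s * (4 / c)).
  have := ler_wpM2l (ltW C0) sab => Csab.
  rewrite -(ger0_norm (dnorm_ge0 N g)) -normrM.
  move: hx' hy' Nx Ny; rewrite !ler_norml => /andP[? ?] /andP[? ?] /andP[? ?] /andP[? ?].
  by apply/andP; split; nra.
have ab : `|a - b| <= (2 * del + C * (s * (4 / c))) / c.
  rewrite ler_pdivlMr//; apply: le_trans abN.
  by rewrite ler_wpM2l.
by nra.
Qed.

(** Heights vary by a factor [1 + tau] at most and the net loses [1 - tau]; the active functional
    thus retains [(1 - tau) / (1 + tau) >= 1 - 2 tau]. *)
Lemma max_dot_cap (I : finType) (f : I -> 'rV[R]_d) (h : I -> R) (tau : R) x :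
  0 < tau -> (forall i, 1 <= h i <= 1 + tau) -> x != 0 ->
  (forall x, x != 0 -> exists i, (1 - tau) * enorm x <= dot (f i) x) ->
  exists i, max_dot f h x = h i * `|dot (f i) x| /\
    (1 - 2 * tau) * enorm x <= `|dot (f i) x|.
Proof.
move=> tau0 h1 x0 net; have [l lx] := net _ x0.
have hge0 i : 0 <= h i by have /andP[] := h1 i; lra.
have [i xi] := max_dot_attained f hge0 l x; exists i; split=> //.
have := max_dot_ge f h l x; rewrite xi => le1.
have := ler_norm (dot (f l) x) => le2.
have /andP[hl1 hl2] := h1 l; have /andP[hi1 hi2] := h1 i.
have di := normr_ge0 (dot (f i) x); have dl := normr_ge0 (dot (f l) x).
have ex := enorm_gt0 x0.
have le3 : (1 - tau) * enorm x <= (1 + tau) * `|dot (f i) x|.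
  rewrite (le_trans lx)// (le_trans le2)//.
  apply: (@le_trans _ _ (h l * `|dot (f l) x|)); first by rewrite ler_peMl.
  by rewrite (le_trans le1)// ler_wpM2r.
have t1 : 0 < 1 + tau by lra.
rewrite -(ler_pM2l t1) (le_trans _ le3)// mulrA ler_wpM2r ?enorm_ge0//.
by nra.
Qed.

End Perturbation.

Section Generic.
Variables (R : realType) (d : nat).
Implicit Types (N : dnorm R d).

Definition int_comb (m k : nat) (A : 'M[int]_(k, m)) (b : 'I_m -> 'rV[R]_d)
  (j : 'I_k) : 'rV[R]_d := \sum_i b i *~ A j i.

Lemma int_comb_lipschitz m k (A : 'M[int]_(k, m)) :
  exists2 L : R, 0 < L & forall b b' r, 0 <= r -> (forall i, enorm (b i - b' i) <= r) ->
    forall j, enorm (int_comb A b j - int_comb A b' j) <= L * r.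
Proof.
pose S : R := \sum_j \sum_i `|(A j i)%:~R|.
have S0 : 0 <= S by apply: sumr_ge0 => j _; exact: sumr_ge0.
exists (S + 1) => [|b b' r r0 br j]; first by rewrite ltr_wpDl.
rewrite /int_comb -sumrB; apply: le_trans (ler_enorm_sum _ _) _.
apply: (@le_trans _ _ ((\sum_i `|(A j i)%:~R|) * r)).
  rewrite mulr_suml; apply: ler_sum => i _.
  by rewrite -mulrzBl -scaler_int enormZ ler_wpM2l.
rewrite ler_wpM2r// /S (bigD1 j)//= -addrA lerDl addr_ge0//.
by apply: sumr_ge0 => j' _; exact: sumr_ge0.
Qed.

(** The cell records, for each coordinate, which of [q + 1] intervals of length [2 r / (q + 1)]
    contains it. *)
Lemma grid_cells (m q : nat) (r : R) : 0 < r ->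
  exists cell : ('I_m -> 'rV[R]_d) -> {ffun 'I_m * 'I_d -> 'I_q.+1},
  forall b b', (forall i, enorm (b i) < r) -> (forall i, enorm (b' i) < r) ->
    cell b = cell b' -> forall i, enorm (b i - b' i) <= d%:R * (2 * r / q.+1%:R).
Proof.
move=> r0; pose y x : R := (x + r) * (q.+1%:R / (2 * r)).
have k0 : 0 < q.+1%:R / (2 * r) by rewrite divr_gt0// mulr_gt0.
(* The strict bounds by [r] keep the index below [q + 1], so [inord] does not fall back on its
   default. *)
exists (fun b => [ffun z => inord (Num.truncn (y (b z.1 0 z.2)))]).
move=> b b' hb hb' bb' i; apply: le_trans (enorm_le_sum _) _.
rewrite -[X in X%:R * _](card_ord d) mulr_natl -sumr_const.
apply: ler_sum => l _; rewrite !mxE.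
have yP x : `|x| < r -> (Num.truncn (y x))%:R <= y x < (Num.truncn (y x)).+1%:R /\
    (Num.truncn (y x) < q.+1)%N.
  rewrite ltr_norml => /andP[x1 x2].
  have y0 : 0 <= y x by rewrite mulr_ge0 ?ltW//; lra.
  have := truncn_itv y0 => yt; split=> //; case/andP: yt => yt _.
  rewrite -(ltr_nat R) (le_lt_trans yt)//.
  rewrite /y mulrA ltr_pdivrMr ?mulr_gt0// mulrC ltr_pM2l//; lra.
have [/andP[b1 b2] b3] := yP _ (le_lt_trans (ler_coord_enorm (b i) l) (hb i)).
have [/andP[c1 c2] c3] := yP _ (le_lt_trans (ler_coord_enorm (b' i) l) (hb' i)).
have : Num.truncn (y (b i 0 l)) = Num.truncn (y (b' i 0 l)).
  move/ffunP: bb' => /(_ (i, l)); rewrite !ffunE /= => /(congr1 val) /=.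
  by rewrite !inordK.
move=> tt; rewrite tt in b1 b2; rewrite -natr1 in b2 c2.
have yy : `|y (b i 0 l) - y (b' i 0 l)| <= 1.
  by rewrite ler_norml; apply/andP; split; lra.
have <- : (q.+1%:R / (2 * r))^-1 = 2 * r / q.+1%:R by rewrite invf_div.
rewrite -[leRHS]mul1r ler_pdivlMr//; apply: le_trans yy.
by rewrite -[X in _ * X]gtr0_norm// -normrM /y -mulrBl opprD addrACA subrr addr0.
Qed.

(* If [b] and [b'] lie in the same cell and the same functional [g] is active at
   the [j]-th combinations of both, then the heights [t], [t'] given to [g] are
   nearly equal; [n] and [D] stand for the old norm and for [`|dot g _|]. *)
Lemma height_gap (e t t' D D' n n' C rho del D0 : R) :
  0 < e -> 0 <= t' <= 2 -> D0 <= D -> `|n - n'| <= C * rho -> `|D - D'| <= rho ->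
  `|n + e * (t * D) - 1| <= del -> `|n' + e * (t' * D') - 1| <= del ->
  e * `|t - t'| * D0 <= 2 * del + (C + 2 * e) * rho.
Proof.
move=> e0 /andP[t0 t2] DD nn dd h1 h2.
apply: (@le_trans _ _ (e * `|t - t'| * D)).
  by rewrite ler_wpM2l// mulr_ge0// ltW.
have etD : e * t' * `|D - D'| <= 2 * e * rho.
  rewrite (@le_trans _ _ (e * t' * rho))//.
    by rewrite ler_wpM2l// mulr_ge0// ltW.
  rewrite ler_wpM2r//; first exact: le_trans dd.
  by rewrite mulrC ler_wpM2r// ltW.
have {}etD : `|e * t' * (D - D')| <= 2 * e * rho.
  by rewrite normrM ger0_norm// mulr_ge0// ltW.
have [D00|D00] := leP 0 D; last first.
  apply: (@le_trans _ _ 0).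
    by rewrite mulr_ge0_le0 ?mulr_ge0 ?(ltW e0) ?(ltW D00).
  have := le_trans (normr_ge0 _) h1; have := le_trans (normr_ge0 _) nn.
  by have := le_trans (normr_ge0 _) etD; lra.
have -> : e * `|t - t'| * D = `|e * (t - t') * D|.
  by rewrite !normrM (gtr0_norm e0) (ger0_norm D00).
move: h1 h2 nn etD; rewrite !ler_norml => /andP[? ?] /andP[? ?] /andP[? ?] /andP[? ?].
by apply/andP; split; lra.
Qed.

End Generic.

Section GenericPerturbation.
Variables (R : realType) (d : nat).
Implicit Types (N : dnorm R d).

(** Meant for [s] the active functional and [sg] the sign of its value: the sign tells a cap from
    its antipode. *)
Lemma card_le_twice_image (I J : finType) (s : J -> I) (sg : J -> bool) :
  (forall j j', s j = s j' -> sg j = sg j' -> j = j') ->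
  (#|J| <= #|[set s j | j : J]| * 2)%N.
Proof.
move=> inj; pose f j := (s j, sg j).
have finj : injective f by move=> j j' [/inj h /h].
have -> : (#|[set s j | j : J]| * 2)%N = #|finset.setX [set s j | j : J] [set: bool]|.
  by rewrite cardsX cardsT card_bool.
rewrite -(card_codom finj); apply: subset_leq_card; apply/fintype.subsetP => w.
by case/codomP => j ->; rewrite !inE /= andbT; apply/imsetP; exists j.
Qed.

(* The perturbation is [N0 + e * max_i h_i |<g_i, x>|], where the [g_i] form a net
   of the sphere so fine that [g_i] is the active functional only on a small cap
   and its antipode, and the [h_i] range over a grid of [G + 1] values. If all the
   choices of heights were bad, then each would come with a cell of [b] (at most
   [(c1 (G + 1)) ^ (d m)] of them), with a tuple of active indices
   ([#|I| ^ (2 d m + 1)]) and, as the vectors are separated, at least [d m + 1]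
   heights determined by these data: too few possibilities once [G] is large. *)
Lemma generic_perturbation N0 m (A : 'M[int]_((2 * (d * m)).+1, m)) (eps eta : R) :
  0 < eps -> 0 < eta ->
  exists2 N, dnorm_dist N0 N < eps & exists2 del, 0 < del <= 2^-1 &
    forall b, (forall i, N (b i) <= 2) ->
      (forall j, `|N (int_comb A b j) - 1| <= del) ->
    exists j j', j != j' /\ enorm (int_comb A b j - int_comb A b j') < eta.
Proof.
move=> eps0 eta0.
have [c [C [c0 C0 hN0]]] := dnorm_equiv_enorm N0.
(* Makes the distance bound [2 e / c ^+ 2] equal to [eps / 2]. *)
pose e : R := eps * c ^+ 2 / 4.
have e0 : 0 < e by rewrite divr_gt0// mulr_gt0// exprn_gt0.
pose C' : R := C + 2 * e; have C'0 : 0 < C' by rewrite addr_gt0// mulr_gt0.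
pose K : R := 4 / c + C' * (4 / c) / c.
have K0 : 0 < K by rewrite addr_gt0 ?divr_gt0// mulr_gt0// divr_gt0.
(* Nearly unit vectors in one cap will be at distance at most [s K + 2 del / c <= eta / 2]. *)
pose s : R := Num.min 1 (eta / (4 * K)).
have s0 : 0 < s by rewrite lt_min ltr01 divr_gt0// mulr_gt0.
have s1 : s <= 1 by rewrite ge_min lexx.
have sK : s * K <= eta / 4.
  have : s <= eta / (4 * K) by rewrite ge_min lexx orbT.
  by rewrite ler_pdivlMr ?mulr_gt0//; lra.
pose tau : R := s ^+ 2 / 4.
have tau0 : 0 < tau by rewrite divr_gt0// exprn_gt0.
have tau1 : tau <= 4^-1.
  have : s ^+ 2 <= 1 by rewrite exprn_ile1 ?(ltW s0).
  by rewrite /tau; lra.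
have ts : 4 * tau <= s ^+ 2 by rewrite /tau; lra.
clearbody tau s.
have [I [g [g1 net]]] := sphere_net d tau0.
have [L L0 lip] := int_comb_lipschitz R d A.
pose r : R := 4 / c; have r0 : 0 < r by rewrite divr_gt0.
(* With a mesh of [2 r / (c1 (G + 1))], [c1 > X] makes the error [C' * rho] small against a height
   step whatever [G] is, so [G] may depend on [c1]. *)
pose X : R := C' * (L * (d%:R * (2 * r))) / (e * tau / (8 * C')).
pose c1 := (Num.truncn X).+1.
have Y0 : 0 < e * tau / (8 * C') by rewrite divr_gt0 ?mulr_gt0.
have X0 : 0 <= X.
  rewrite divr_ge0 ?(ltW Y0)// (mulr_ge0 (ltW C'0))// (mulr_ge0 (ltW L0))//.
  by rewrite mulr_ge0// mulr_ge0// ltW.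
have Xc1 : X < c1%:R by have /andP[] := truncn_itv X0.
pose k := (2 * (d * m)).+1.
(* The codes number [(c1 (G + 1)) ^ (m d) * #|I| ^ k = G (G + 1) ^ (m d)], fewer than
   [(G + 1) ^ (d m + 1)]. *)
pose G := (c1 ^ (m * d) * #|I| ^ k)%N.
pose q := (c1 * G.+1).-1.
have qE : q.+1 = (c1 * G.+1)%N by rewrite prednK.
have G0 : 0 < G.+1%:R :> R by rewrite ltr0n.
have [cell cellP] := grid_cells d m q r0.
pose rho : R := L * (d%:R * (2 * r / q.+1%:R)).
have rho_small : C' * rho < e * tau / (8 * C') / G.+1%:R.
  have -> : C' * rho = C' * (L * (d%:R * (2 * r))) / c1%:R / G.+1%:R.
    by rewrite /rho qE natrM invfM !mulrA.
  rewrite ltr_pM2r ?invr_gt0// ltr_pdivrMr ?ltr0n//.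
  by rewrite [ltRHS]mulrC -ltr_pdivrMr.
(* The second term serves the separation by [eta], the third the comparison of heights. *)
pose del : R := Num.min (Num.min 4^-1 (eta * c / 8)) (e * tau / (8 * C') / G.+1%:R / 4).
have del0 : 0 < del.
  rewrite !lt_min invr_gt0 ltr0n /= (divr_gt0 (mulr_gt0 eta0 c0))//=.
  by rewrite (divr_gt0 (divr_gt0 Y0 G0)).
have del1 : del <= 4^-1 by rewrite !ge_min lexx.
have del2 : del <= eta * c / 8 by rewrite !ge_min lexx !orbT.
have del3 : del <= e * tau / (8 * C') / G.+1%:R / 4 by rewrite !ge_min lexx !orbT.
clearbody del.
pose h (a : {ffun I -> 'I_G.+1}) i : R := 1 + tau * ((a i)%:R / G.+1%:R).
have h1 a i : 1 <= h a i <= 1 + tau.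
  rewrite /h; apply/andP; split.
    by rewrite lerDl mulr_ge0 ?divr_ge0 ?(ltW tau0) ?(ltW G0).
  rewrite lerD2l ler_piMr ?(ltW tau0)// ler_pdivrMr// mul1r ler_nat.
  exact: ltnW.
have h0 a i : 0 <= h a i by have /andP[] := h1 a i; lra.
pose N a := perturbed g (h0 a) N0 (ltW e0).
have NE a x : N a x = N0 x + e * max_dot g (h a) x by [].
have M_le a x : max_dot g (h a) x <= 2 * enorm x.
  apply: max_dot_leP => [|i]; first by rewrite mulr_ge0 ?enorm_ge0.
  have /andP[hi1 hi2] := h1 a i.
  apply: ler_pM => //; first by lra.
  by have := norm_dot_le (g i) x; rewrite g1 mul1r.
have N_bounds a x : c * enorm x <= N a x /\ N a x <= C' * enorm x.
  rewrite NE; have [n1 n2] := hN0 x; have := M_le a x.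
  have := max_dot_ge0 g (h a) x => m0 /(ler_wpM2l (ltW e0)) m1.
  have em0 : 0 <= e * max_dot g (h a) x by rewrite mulr_ge0// ltW.
  by rewrite /C'; split; lra.
have N_dist a : dnorm_dist N0 (N a) < eps.
  apply: le_lt_trans (_ : 2 * e / c ^+ 2 < _).
    apply: dnorm_dist_le => //; first by rewrite mulr_ge0// ltW.
      by move=> x; exact: (hN0 x).1.
    move=> x; rewrite NE; have := M_le a x.
    have := max_dot_ge0 g (h a) x => m0 /(ler_wpM2l (ltW e0)) m1.
    have em0 : 0 <= e * max_dot g (h a) x by rewrite mulr_ge0// ltW.
    by split; lra.
  have -> : 2 * e / c ^+ 2 = eps / 2.
    by rewrite /e; field; rewrite gt_eqF.
  by lra.
apply: contrapT => noN.
have bad (a : {ffun I -> 'I_G.+1}) : exists b, [/\ forall i, N a (b i) <= 2,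
    forall j, `|N a (int_comb A b j) - 1| <= del &
    forall j j', j != j' -> eta <= enorm (int_comb A b j - int_comb A b j')].
  apply: contrapT => nob; apply: noN; exists (N a); first exact: N_dist.
  exists del.
    by apply/andP; split=> //; lra.
  move=> b b2 bdel; apply: contrapT => far; apply: nob; exists b; split=> //.
  move=> j j' jj'; rewrite leNgt; apply/negP => close.
  by apply: far; exists j, j'.
pose Q (a : {ffun I -> 'I_G.+1}) (w : {ffun 'I_m * 'I_d -> 'I_q.+1})
    (t : {ffun 'I_k -> I}) := exists b, [/\ cell b = w, forall i, enorm (b i) < r,
    forall j, `|N a (int_comb A b j) - 1| <= del,
    forall j, max_dot g (h a) (int_comb A b j)
        = h a (t j) * `|dot (g (t j)) (int_comb A b j)| /\
      (1 - 2 * tau) * enorm (int_comb A b j) <= `|dot (g (t j)) (int_comb A b j)| &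
    forall j j', j != j' -> eta <= enorm (int_comb A b j - int_comb A b j')].
have size_unit a x : `|N a x - 1| <= del -> enorm x <= 2 / c /\ (2 * C')^-1 <= enorm x.
  rewrite ler_norml => /andP[x1 x2]; have [n1 n2] := N_bounds a x; split.
    by rewrite ler_pdivlMr// mulrC; lra.
  by rewrite -[leLHS]mul1r ler_pdivrMr ?mulr_gt0//; lra.
have : (#|'I_G.+1| ^ (d * m).+1 <=
    #|{: {ffun 'I_m * 'I_d -> 'I_q.+1}}| * #|I| ^ #|'I_k|)%N.
  apply: (pigeonhole_ffuns (Q := Q)).
  - by rewrite card_ord.
  - move=> a; have [b [b2 bdel bsep]] := bad a.
    have ex j : exists i, max_dot g (h a) (int_comb A b j)
        = h a i * `|dot (g i) (int_comb A b j)| /\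
      (1 - 2 * tau) * enorm (int_comb A b j) <= `|dot (g i) (int_comb A b j)|.
      apply: max_dot_cap => //; have [_] := size_unit _ _ (bdel j).
      apply: contraTneq => ->; rewrite enorm0 -ltNge invr_gt0 mulr_gt0//.
    exists (cell b), [ffun j => sval (cid (ex j))], b; split=> //.
      move=> i; have := (N_bounds a (b i)).1; have := b2 i => h2 h3.
      by rewrite /r ltr_pdivlMr// mulrC; lra.
    by move=> j; rewrite ffunE; exact: svalP (cid (ex j)).
  (* From [2 d m + 1] separated vectors, at most two per functional, come at least [d m + 1] active
     functionals. *)
  - move=> a w t [b [_ _ bdel bcap bsep]].
    suff : (k <= #|[set t j | j : 'I_k]| * 2)%N.
      by move=> kX; rewrite -(ltn_pmul2r (isT : (0 < 2)%N)) [ltnLHS]mulnC.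

    rewrite -[X in (X <= _)%N](card_ord k).
    apply: (card_le_twice_image (sg := fun j => 0 <= dot (g (t j)) (int_comb A b j))).
    move=> j j' tj sj; apply/eqP; apply: contraT => jj'.
    have := bsep _ _ jj'; rewrite leNgt => /negP; case.
    have [_ capj] := bcap j; have [_ capj'] := bcap j'; rewrite -tj in capj' sj.
    have [xj _] := size_unit _ _ (bdel j); have [xj' _] := size_unit _ _ (bdel j').
    have close gg : enorm gg = 1 ->
        (1 - 2 * tau) * enorm (int_comb A b j) <= dot gg (int_comb A b j) ->
        (1 - 2 * tau) * enorm (int_comb A b j') <= dot gg (int_comb A b j') ->
        enorm (int_comb A b j - int_comb A b j') < eta.
      move=> gg1 cj cj'; apply: le_lt_trans (same_cap_close c0 C'0 (N_bounds a) gg1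
        (ltW s0) ts cj cj' (bdel j) (bdel j') xj xj') _.
      have -> : s * (4 / c) + (2 * del + C' * (s * (4 / c))) / c
          = s * K + 2 * (del / c) by rewrite /K; field; rewrite gt_eqF.
      have : del / c <= eta / 8 by rewrite ler_pdivrMr// mulrAC.
      by lra.
    have dotNl x : dot (- g (t j)) x = - dot (g (t j)) x.
      by rewrite /dot -sumrN; apply: eq_bigr => i _; rewrite mxE mulNr.
    have [pj|nj] := leP 0 (dot (g (t j)) (int_comb A b j)).
      rewrite pj in sj; apply: (close (g (t j))) => //.
        by rewrite ger0_norm in capj.
      by rewrite ger0_norm// in capj'; rewrite -sj.
    have nj' : dot (g (t j)) (int_comb A b j') < 0.
      by rewrite ltNge -sj -ltNge.
    apply: (close (- g (t j))); rewrite ?enormN// dotNl.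
      by rewrite ltr0_norm in capj.
    by rewrite ltr0_norm in capj'.
  (* Distinct heights differ by at least [tau / (G + 1)], more than [height_gap] allows within one
     cell. *)
  - move=> a a' w t [b [bw br bdel bcap _]] [b' [bw' br' bdel' bcap' _]] j.
    apply: contrapT => aa'.
    have vv : enorm (int_comb A b j - int_comb A b' j) <= rho.
      apply: lip; first by rewrite mulr_ge0// divr_ge0// mulr_ge0// ltW.
      by apply: cellP => //; rewrite bw bw'.
    have [_ vlarge] := size_unit _ _ (bdel j).
    have [m1 cap1] := bcap j; have [m2 _] := bcap' j.
    have := bdel j; have := bdel' j; rewrite !NE m1 m2.
    set v := int_comb A b j in vv vlarge cap1 *; set v' := int_comb A b' j in vv *.
    move=> u2 u1.
    have D0 : (4 * C')^-1 <= `|dot (g (t j)) v|.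
      apply: le_trans cap1; have -> : (4 * C')^-1 = 2^-1 * (2 * C')^-1.
        by field; rewrite gt_eqF.
      apply: ler_pM => //; first by rewrite invr_ge0 mulr_ge0// ltW.
      lra.
    have nn : `|N0 v - N0 v'| <= C * rho.
      rewrite (le_trans (ler_dnormB _ _ _))// (le_trans (hN0 _).2)//.
      by rewrite ler_pM2l.
    have dd : `| `|dot (g (t j)) v| - `|dot (g (t j)) v'| | <= rho.
      apply: le_trans (ler_dist_dist _ _) _; rewrite -dotNr -dotDr.
      by apply: le_trans (norm_dot_le _ _) _; rewrite g1 mul1r.
    have t02 : 0 <= h a' (t j) <= 2 by rewrite h0 /=; have /andP[] := h1 a' (t j); lra.
    have := height_gap e0 t02 D0 nn dd u1 u2.
    have hh : tau / G.+1%:R <= `|h a (t j) - h a' (t j)|.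
      rewrite /h opprD addrACA subrr add0r -mulrBr -mulrBl normrM gtr0_norm//.
      rewrite ler_pM2l// normrM normfV [X in _ / X]ger0_norm//.
      rewrite ler_peMl ?invr_ge0//.
      have : a (t j) != a' (t j) by apply/eqP.
      rewrite -val_eqE neq_ltn /= => /orP[lt|lt].
        by rewrite distrC -natrB ?normr_nat ?ler1n ?subn_gt0// ltnW.
      by rewrite -natrB ?normr_nat ?ler1n ?subn_gt0// ltnW.
    apply/negP; rewrite -ltNge.
    apply: (@lt_le_trans _ _ (e * (tau / G.+1%:R) * (4 * C')^-1)); last first.
      have c4 : 0 <= (4 * C')^-1 by rewrite invr_ge0 mulr_ge0// ltW.
      by rewrite ler_wpM2r// ler_pM2l.
    have -> : e * (tau / G.+1%:R) * (4 * C')^-1 = 2 * (e * tau / (8 * C') / G.+1%:R).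
      by field; rewrite !gt_eqF.
    have := divr_gt0 Y0 G0; move: rho_small del3; rewrite -/C'.
    set y := (e * tau / _ / _); set z := C' * rho; clearbody y z; clear.
    by lra.
rewrite card_ffun card_prod !card_ord qE expnMn expnS.
have := expn_gt0 G.+1 (m * d); rewrite /= => G1.
rewrite [(d * m)%N]mulnC mulnAC leq_pmul2r// -/G.
by rewrite ltnn.
Qed.

End GenericPerturbation.

(** * Typical norms *)

Section Typical.
Variables (R : realType) (d : nat).
Implicit Types (N : dnorm R d).

(* [m] vectors of dimension [d] have [d m] degrees of freedom, and [2 d m + 1]
   distinct vectors contain [d m + 1] pairwise non-opposite ones. *)
Definition overdetermined m (A : 'M[int]_((2 * (d * m)).+1, m)) (q : nat) :
    set (dnorm R d) :=
  [set N : dnorm R d | exists b, [/\ forall i, N (b i) = 1,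
    forall j, N (int_comb A b j) = 1 &
    forall j j', j != j' ->
      q.+1%:R^-1 <= enorm (int_comb A b j - int_comb A b j')]]%classic.

(** Near [N0] there is a perturbed [N] with its tolerance [del], and a whole ball around [N] misses
    the set: where a norm of that ball equals 1, [N] is within [del] of 1, and the separation is
    Euclidean, hence the same for both norms. *)
Lemma overdetermined_nowhere_dense m (A : 'M[int]_((2 * (d * m)).+1, m)) q :
  nowhere_dense (overdetermined A q).
Proof.
apply/seteqP; split=> // N0; rewrite /interior /= => /nbhs_ballP[eps /= eps0 sub].
have q0 : 0 < q.+1%:R^-1 :> R by rewrite invr_gt0.
have [N NN0 [del /andP[del0 del2] gen]] := generic_perturbation N0 A eps0 q0.
have /sub clN : ball N0 eps N by rewrite ballEmdist.
have [c [C [_ C0 hN]]] := dnorm_equiv_enorm N.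
pose r : R := del / (2 * C); have r0 : 0 < r by rewrite divr_gt0// mulr_gt0.
have CrE : 2 * (C * r) = del by rewrite /r; field; rewrite gt_eqF.
have [N' [[b [b1 v1 sep]] NN']] := clN _ (nbhsx_ballx N _ r0).
rewrite ballEmdist /= in NN'.
have near x : N' x = 1 -> `|N x - 1| <= del.
  by rewrite -CrE; apply: dnorm_dist_near => //; [lra | move=> y; exact: (hN y).2].
have [||j [j' [jj' close]]] := gen b.
- move=> i; have := near _ (b1 i); rewrite ler_norml => /andP[_]; lra.
- by move=> j; exact: near.
by have := sep _ _ jj'; rewrite leNgt close.
Qed.

(** The triples [(m, A, q)] are enumerated through their codes; a number that is no code gives the
    empty set. *)
Definition overdetermined_nth (n : nat) : set (dnorm R d) :=
  match choice.unpickle n : option {m : nat & ('M[int]_((2 * (d * m)).+1, m) * nat)%type} with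
  | Some w => overdetermined (tagged w).1 (tagged w).2
  | None => classical_sets.set0
  end.

Definition atypical : set (dnorm R d) :=
  (\bigcup_(n in [set: nat]) overdetermined_nth n)%classic.

Lemma meagre_atypical : meagre atypical.
Proof.
exists overdetermined_nth => // n; rewrite /overdetermined_nth.
case: (choice.unpickle n) => [w|]; first exact: overdetermined_nowhere_dense.
by rewrite /nowhere_dense closure0 interior0.
Qed.

Lemma typical_few_in_zspan N (S W : seq 'rV[R]_d) : ~ atypical N ->
  all (fun w => N w == 1) S -> all (fun w => N w == 1) W -> uniq W ->
  (forall w, w \in W -> zspan S w) -> (size W <= 2 * d.+1 * size S)%N.
Proof.
move=> typ S1 W1 uW WS; rewrite leqNgt; apply/negP => big; apply: typ.
set m := size S; pose k := (2 * (d * m)).+1.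
(* [W] has more than [2 (d + 1) m >= 2 d m] vectors; [d + 1] instead of [d] keeps the factor
   positive when [d = 0]. *)
have kW (j : 'I_k) : (j < size W)%N.
  apply: leq_trans big; rewrite (leq_trans (ltn_ord j))// /k ltnS mulnA.
  by rewrite leq_mul2r leq_mul2l leqnSn !orbT.
have WP (j : 'I_k) : W`_j \in W by exact: mem_nth.
pose a j := sval (cid (WS _ (WP j))).
pose A : 'M[int]_(k, m) := \matrix_(j, i) a j i.
pose b (i : 'I_m) := S`_i.
have AE j : int_comb A b j = W`_j.
  rewrite (svalP (cid (WS _ (WP j)))) /int_comb; apply: eq_bigr => i _.
  by rewrite mxE.
(* The least distance among these vectors, capped at 1, is positive as [W] has no repetition; [q] is
   the integer part of [1 / sep], so [1 / (q + 1) <= sep]. *)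
pose sep : R := \big[Num.min/1]_(z : 'I_k * 'I_k | z.1 != z.2) enorm (W`_z.1 - W`_z.2).
have sep0 : 0 < sep.
  apply/bigmin_gtP; split=> // z zz; apply: enorm_gt0; rewrite subr_eq0.
  by rewrite nth_uniq.
exists (choice.pickle (Tagged (fun m => ('M[int]_((2 * (d * m)).+1, m) * nat)%type)
  (A, Num.truncn sep^-1))) => //.
rewrite /overdetermined_nth choice.pickleK /=; exists b; split.
- by move=> i; apply/eqP; move/allP: S1; apply; exact: mem_nth.
- by move=> j; rewrite AE; apply/eqP; move/allP: W1; apply; exact: WP.
move=> j j' jj'; rewrite !AE; apply: (@le_trans _ _ sep).
  rewrite -[leRHS]invrK lef_pV2 ?posrE ?invr_gt0// ltW//.
  have si0 : 0 <= sep^-1 by rewrite invr_ge0 ltW.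
  by have /andP[] := truncn_itv si0.
by apply: (bigmin_le_cond _ (j := (j, j'))).
Qed.

End Typical.

(** * Pinned distances from unit distances *)

Section Pinned.
Variables (R : realType) (d : nat) (N : dnorm R d) (B : nat).
Hypothesis B_gt0 : (0 < B)%N.
Hypothesis few : forall S W : seq 'rV[R]_d,
  all (fun w => N w == 1) S -> all (fun w => N w == 1) W -> uniq W ->
  (forall w, w \in W -> zspan S w) -> (size W <= B * size S)%N.
Variable P : {fset 'rV[R]_d}.

Definition distance_type :=
  seq_sub (codom (fun z : P * P => N (val z.1 - val z.2))).

Definition distance (z : P * P) : distance_type :=
  SeqSub (codom_f (fun z : P * P => N (val z.1 - val z.2)) z).

Definition pairs_at (a : distance_type) : {set P * P} :=
  [set z | (distance z == a) && (z.1 != z.2)].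

Definition points_at (a : distance_type) : {set P} :=
  [set x | [exists y, (x, y) \in pairs_at a]].

(** Dividing all points by [a] turns the distance [a] into 1; the bound for unit pairs applies to
    [points_at a] with [n = #|P|], and [ln #|points_at a| <= ln #|P|]. *)
Lemma card_pairs_at a : (1 < #|` P|)%N ->
  #|pairs_at a|%:R <= 24 * B%:R * ln #|` P|%:R ^+ 2 * #|points_at a|%:R :> R.
Proof.
move=> P1; have lnP : 0 <= ln #|` P|%:R :> R by rewrite ln_ge0// ler1n ltnW.
have [->|/finset.set0Pn[[x y]]] := eqVneq (pairs_at a) finset.set0.
  by rewrite cards0 !mulr_ge0.
rewrite inE /= => /andP[/eqP xya xy].
have a0 : 0 < val a.
  by rewrite -xya /=; apply: dnorm_gt0; rewrite subr_eq0 -[_ == _]/(x == y).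
pose p (x : P) := (val a)^-1 *: val x.
have pinj : injective p.
  move=> u v; move/(scalerI (invr_neq0 (lt0r_neq0 a0))); exact: val_inj.
have pN u v : N (p u - p v) = (val a)^-1 * N (val u - val v).
  by rewrite -scalerBr dnormZ normfV gtr0_norm.
pose E : pred 'rV[R]_d := fun w => N w == 1.
have E0 : ~~ E 0 by rewrite /E dnorm0 eq_sym oner_eq0.
have sub : (#|pairs_at a| <= #|unit_pairs E p (points_at a) (points_at a)|)%N.
  apply: subset_leq_card; apply/fintype.subsetP => -[u v].
  rewrite inE /= => /andP[/eqP uva uv].
  have Nuv : N (val u - val v) = val a by rewrite -uva.
  rewrite !inE /= /E pN Nuv mulVf ?lt0r_neq0// eqxx andbT.
  apply/andP; split; apply/existsP.
    by exists v; rewrite inE /= uv andbT; apply/eqP.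
  exists u; rewrite inE /= [v == u]eq_sym uv andbT; apply/eqP/val_inj => /=.
  by rewrite -Nuv -dnormN opprB.
have VP : (#|points_at a| <= #|` P|)%N by rewrite cardfE max_card.
have := few_unit_pairs R B_gt0 E0 few pinj P1 VP.
rewrite -(ler_nat R) in sub; move=> bound; apply: (le_trans sub).
apply: (le_trans bound); rewrite expr2 !mulrA -!mulrA.
do 3![rewrite ler_wpM2l//]; rewrite mulrC ler_wpM2r//.
have [->|V0] := posnP #|points_at a|; first by rewrite ln0.
by rewrite ler_ln ?posrE ?ltr0n ?ler_nat// ltnW.
Qed.

Let card_sum (T : finType) (X : {set T}) : #|X| = (\sum_x (x \in X))%N.
Proof. by rewrite -sum1_card big_mkcond; apply: eq_bigr => x _; case: (x \in X). Qed.

(** Double counting: a point is in [points_at a] only if [a] is one of the distances seen from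
    it. *)
Lemma sum_card_points_at :
  (\sum_a #|points_at a| <= \sum_(x : P) #|` distances_from N P (val x)|)%N.
Proof.
under eq_bigr => a _ do rewrite card_sum.
rewrite exchange_big /=; apply: leq_sum => x _.
pose D := [set a | x \in points_at a].
have -> : (\sum_a (x \in points_at a) = #|D|)%N.
  by rewrite card_sum; apply: eq_bigr => a _; rewrite [a \in D]inE.
rewrite cardE -(size_map val); apply: uniq_leq_size.
  by rewrite (map_inj_uniq val_inj) enum_uniq.
move=> _ /mapP[a + ->]; rewrite mem_enum inE inE => /existsP[y].
rewrite inE /= => /andP[/eqP <- _]; apply/imfsetP; exists (val y) => //.
exact: valP.
Qed.

Lemma sum_card_pairs_at : (\sum_a #|pairs_at a| = #|` P| * #|` P|.-1)%N.
Proof.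
under eq_bigr => a _ do rewrite card_sum.
rewrite exchange_big /=.
transitivity (\sum_(x : P) \sum_(y : P) (y != x))%N; last first.
  rewrite cardfE -sum_nat_const; apply: eq_big => // x _.
  rewrite -(cardC1 x) -sum1_card [RHS]big_mkcond; apply: eq_bigr => y _.
  by rewrite !inE; case: (y == x).
rewrite [RHS]pair_big /=; apply: eq_bigr => -[x y] _ /=.
rewrite (bigD1 (distance (x, y)))//= big1 ?addn0 => [|a ax].
  by rewrite inE eqxx /= eq_sym.
by rewrite inE eq_sym (negbTE ax).
Qed.

Lemma pinned_distances : (1 < #|` P|)%N -> exists2 x, x \in P &
  (96 * B%:R)^-1 * (#|` P|%:R / ln #|` P|%:R ^+ 2)
    <= #|` distances_from N P x|%:R :> R.
Proof.
move=> P1; set n : R := #|` P|%:R; set K : R := 24 * B%:R.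
have K0 : 0 < K by rewrite mulr_gt0// ltr0n.
have n2 : 2 <= n by rewrite ler_nat.
have lnn : 0 < ln n by rewrite ln_gt0//; lra.
(* With at most [t] distances at each point, [n (n - 1) <= K (ln n)^2 n t = n (n / 4)], impossible
   for [n >= 2]; the 96 is [4 * 24]. *)
apply: contrapT => few_dist; pose t : R := (4 * K)^-1 * (n / ln n ^+ 2).
have small (x : P) : #|` distances_from N P (val x)|%:R <= t.
  rewrite leNgt; apply/negP => /ltW le; apply: few_dist; exists (val x) => //.
    exact: valP.
  suff <- : 4 * K = 96 * B%:R by [].
  by rewrite /K mulrA -natrM.
have total : n * (n - 1) <= K * ln n ^+ 2 * (n * t).
  have -> : n * (n - 1) = (\sum_a #|pairs_at a|)%:R.
    by rewrite sum_card_pairs_at natrM -subn1 natrB// ltnW.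
  rewrite natr_sum; apply: (@le_trans _ _ (K * ln n ^+ 2 * (\sum_a #|points_at a|)%:R)).
    rewrite natr_sum mulr_sumr; apply: ler_sum => a _; exact: card_pairs_at.
  rewrite ler_wpM2l//; first by rewrite mulr_ge0 ?(ltW K0)// sqr_ge0.
  apply: (@le_trans _ _ (\sum_(x : P) #|` distances_from N P (val x)|)%:R).
    by rewrite ler_nat sum_card_points_at.
  rewrite natr_sum /n cardfE mulr_natl -sumr_const.
  by apply: ler_sum => x _; exact: small.
have eq4 : K * ln n ^+ 2 * (n * t) = n * (n / 4).
  by rewrite /t; field; rewrite !gt_eqF.
rewrite eq4 ler_pM2l in total; last by lra.
by lra.
Qed.

End Pinned.

Theorem theorem4p1 (R : realType) (d : nat) :
  holds_for_most (fun N : dnorm R d =>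
    exists2 c : R, 0 < c &
    exists n0 : nat, forall P : {fset 'rV[R]_d}, (n0 <= #|` P|)%N ->
    exists2 x : 'rV[R]_d, x \in P &
      c * (#|` P|%:R / ln #|` P|%:R ^+ 2) <= #|` distances_from N P x|%:R).
Proof.
exists (@atypical R d); first exact: meagre_atypical.
(* [B] depends on [d] only, so all typical norms share the constant. *)
move=> N typ; pose B := (2 * d.+1)%N.
exists (96 * B%:R)^-1; first by rewrite invr_gt0 mulr_gt0// ltr0n.
exists 2%N => P P2; apply: pinned_distances => // S W.
exact: typical_few_in_zspan.
Qed.
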